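(* Let $\boldsymbol{k}$ be an algebraically closed field of characteristic other than $2$, let $R=\boldsymbol{k}[x_0,\ldots,x_n]$, and let $\boldsymbol{E}$ and $\boldsymbol{G}$ be finitely generated graded $R$-modules such that $\boldsymbol{E}$ is $m$-linearly presented up to order $1$ and $\boldsymbol{G}$ is $m$-linearly presented up to order $2$, with minimal graded free resolutions $$\cdots \to E^2\xrightarrow{e_2} E^1 \xrightarrow{e_1} E^0 \xrightarrow{e_0} \boldsymbol{E}\to 0,\qquad \cdots \to G^2\xrightarrow{g_2} G^1 \xrightarrow{g_1} G^0 \xrightarrow{g_0} \boldsymbol{G}\to 0.$$ Let $\mu:\boldsymbol{E}\to\boldsymbol{G}$ be a surjective morphism of graded modules, let $\mu^i:E^i\to G^i$ be the induced maps, and let $\nu^2:\operatorname{im}(e_2)\to\operatorname{im}(g_2)$ be the restriction of $\mu^1$. Assume that $\mu^1$ is surjective and furthermore that: (i) the sheaves $E=\tilde{\boldsymbol{E}}$ and $G=\tilde{\boldsymbol{G}}$ are vector bundles on $\mathbb{P}^n$ of rank $r$ and $s$ respectively; (ii) the map $\nu^2$ has Artinian cokernel. Set $a=\beta_{0,m}(\boldsymbol{E})-\beta_{0,m}(\boldsymbol{G})$ and $b=\beta_{1,m+1}(\boldsymbol{E})-\beta_{1,m+1}(\boldsymbol{G})$. Then the presentation matrix of $\boldsymbol{F}=\ker(\mu)$ has a linear part $A$ of size $a\times b$ and constant corank $r-s$. Moreover the sheafification $F=\tilde{\boldsymbol{F}}$ of $\boldsymbol{F}$ is isomorphic to the kernel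 of $\tilde{\mu}:E\to G$.
   Context: $R$ has the standard grading. All modules are finitely generated and graded, and morphisms of modules are homogeneous of degree $0$; $\boldsymbol{M}(q)_p=\boldsymbol{M}_{p+q}$. $\beta_{i,j}(\boldsymbol{M})$ denotes the graded Betti number: the $i$-th term of the minimal graded free resolution of $\boldsymbol{M}$ is $\bigoplus_j R(-j)^{\beta_{i,j}(\boldsymbol{M})}$. A tilde denotes the associated coherent sheaf (or morphism of sheaves) on $\mathbb{P}^n=\operatorname{Proj} R$. $\boldsymbol{M}$ is called $m$-linearly presented up to order $k$ if, in its minimal graded free resolution $\cdots\to M^1\to M^0\to\boldsymbol{M}\to 0$, one has $M^i\simeq R(-m-i)^{\beta_{i,m+i}}$ for $0\le i\le k$. The maps $\mu^i$ form a morphism of complexes lifting $\mu$, determined up to chain homotopy. Under these hypotheses $\boldsymbol{F}$ is generated in degree $m$ and its minimal generators have first syzygies generated in degrees $m+1$ and $m+2$. The linear part of the (minimal) presentation matrix of $\boldsymbol{F}$ is the submatrix $A: R(-m-1)^b\to R(-m)^a$ corresponding to the minimal syzygies of degree $m+1$; its entries are linear forms. An $a\times b$ matrix of linear forms has constant corank $c$ if its evaluation at every nonzero point of $\boldsymbol{k}^{n+1}$ has rank $a-c$. *)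

(* Defs.v *)
From HB Require Import structures.
From mathcomp Require Import all_boot all_order all_algebra.
From mathcomp Require Import ring_quotient generic_quotient.
From mathcomp Require Import boolp.
From mathcomp Require Import mpoly.
From mathcomp Require Import ring.

Set Implicit Arguments.
Unset Strict Implicit.
Unset Printing Implicit Defensive.

Import Order.TTheory GRing.Theory.
Local Open Scope quotient_scope.
Local Open Scope ring_scope.

Section LinearMaps.
Variables (R : pzRingType) (U V : lmodType R) (f : {linear U -> V}).

Definition lker : {pred U} := [pred x | f x == 0].

Definition limg : {pred V} := [pred y | `[< exists x, y = f x >]].

Fact lker_submod : submod_closed lker.
Proof.
split=> [|a x y]; rewrite !inE ?linear0 // => /eqP fx /eqP fy.
by rewrite linearP fx fy scaler0 addr0.
Qed.
HB.instance Definition _ := GRing.isSubmodClosed.Build R U lker lker_submod.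

Fact limgP y : reflect (exists x, y = f x) (y \in limg).
Proof. by rewrite inE; apply: asboolP. Qed.

Fact limg_submod : submod_closed limg.
Proof.
split=> [|a _ _ /limgP[x ->] /limgP[y ->]]; apply/limgP.
  by exists 0; rewrite linear0.
by exists (a *: x + y); rewrite linearP.
Qed.
HB.instance Definition _ := GRing.isSubmodClosed.Build R V limg limg_submod.

Definition ker_mod : Type := {x : U | x \in lker}.
HB.instance Definition _ := [isSub of ker_mod for (@sval U _)].
HB.instance Definition _ := [Choice of ker_mod by <:].
HB.instance Definition _ := [SubChoice_isSubLmodule of ker_mod by <:].

Definition im_mod : Type := {y : V | y \in limg}.
HB.instance Definition _ := [isSub of im_mod for (@sval V _)].
HB.instance Definition _ := [Choice of im_mod by <:].
HB.instance Definition _ := [SubChoice_isSubLmodule of im_mod by <:].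

Definition coker : Type := Quotient.quot limg.
HB.instance Definition _ := GRing.Zmodule.on coker.

Definition coker_proj (y : V) : coker := \pi_(Quotient.quot limg) y.

Fact coker_proj_eq x y : coker_proj x = coker_proj y <-> x - y \in limg.
Proof.
rewrite Quotient.idealrBE; split=> [h|/eqP h //].
by apply/eqP.
Qed.

Fact coker_projB : {morph coker_proj : x y / x - y}.
Proof. by move=> x y; rewrite /coker_proj !piE. Qed.

Fact coker_projD : {morph coker_proj : x y / x + y}.
Proof. by move=> x y; rewrite /coker_proj !piE. Qed.

Fact coker_projK (c : coker) : coker_proj (repr (c : Quotient.quot limg)) = c.
Proof. exact: reprK. Qed.

Definition coker_scale (a : R) (c : coker) : coker :=
  coker_proj (a *: repr (c : Quotient.quot limg)).

Fact coker_projZ a y : coker_scale a (coker_proj y) = coker_proj (a *: y).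
Proof.
apply/coker_proj_eq; rewrite -scalerBr rpredZ //.
by apply/coker_proj_eq; rewrite coker_projK.
Qed.

Fact coker_scalerA a b c :
  coker_scale a (coker_scale b c) = coker_scale (a * b) c.
Proof. by rewrite -(coker_projK c) !coker_projZ scalerA. Qed.

Fact coker_scale1r : left_id 1 coker_scale.
Proof. by move=> c; rewrite -(coker_projK c) coker_projZ scale1r. Qed.

Fact coker_scalerDr : right_distributive coker_scale +%R.
Proof.
move=> a c d; rewrite -(coker_projK c) -(coker_projK d) -coker_projD.
by rewrite !coker_projZ -coker_projD scalerDr.
Qed.

Fact coker_scalerDl c : {morph coker_scale^~ c : a b / a + b}.
Proof.
by move=> a b; rewrite -(coker_projK c) !coker_projZ -coker_projD scalerDl.
Qed.

HB.instance Definition _ := GRing.Zmodule_isLmodule.Build R coker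
  coker_scalerA coker_scale1r coker_scalerDr coker_scalerDl.

End LinearMaps.

Definition artinian (R : pzRingType) (M : lmodType R) : Prop :=
  forall S : nat -> submodClosed M,
    (forall i, {subset S i.+1 <= S i}) ->
    exists N, forall i, (N <= i)%N -> S i =i S N.

Definition finitely_generated (R : pzRingType) (M : lmodType R) : Prop :=
  exists (N : nat) (g : 'I_N -> M),
    forall x : M, exists c : 'I_N -> R, x = \sum_i c i *: g i.

Section GradedModules.
Variables (k : fieldType) (n : nat).
Local Notation R := {mpoly k[n.+1]}.

(* p lies in R_d, with R_d = 0 for d < 0. *)
Definition zhomog (d : int) (p : R) : Prop :=
  match d with Posz e => p \is e.-homog | Negz _ => p = 0 end.

Record grmod := GrMod {
  gcar :> lmodType R;
  gpiece : int -> gcar -> Prop;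
  gpiece0 : forall d, gpiece d 0;
  gpieceB : forall d x y, gpiece d x -> gpiece d y -> gpiece d (x - y);
  gpieceZ : forall (e : nat) d (p : R) x,
    p \is e.-homog -> gpiece d x -> gpiece (e%:Z + d) (p *: x);
  gpiece_sum : forall x, exists (s : seq int) (c : int -> gcar),
    [/\ uniq s, forall d, gpiece d (c d) & x = \sum_(d <- s) c d];
  gpiece_direct : forall (s : seq int) (c : int -> gcar), uniq s ->
    (forall d, gpiece d (c d)) -> \sum_(d <- s) c d = 0 ->
    forall d, d \in s -> c d = 0
}.

Record grhom (M N : grmod) := GrHom {
  ghom :> {linear M -> N};
  ghom_deg : forall d x, gpiece d x -> gpiece d (ghom x)
}.

Fact zhomog0 d : zhomog d 0.
Proof. by case: d => e //=; apply: dhomog0. Qed.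

Fact zhomogB d p q : zhomog d p -> zhomog d q -> zhomog d (p - q).
Proof.
case: d => e /=; first by move=> hp hq; apply: rpredB.
by move=> -> ->; rewrite subrr.
Qed.

Fact zhomogM (e : nat) d p q :
  p \is e.-homog -> zhomog d q -> zhomog (e%:Z + d) (p * q).
Proof.
case: d => d hp /= hq; first exact: dhomogM.
by rewrite hq mulr0; apply: zhomog0.
Qed.

Definition zpihomog (d : int) (p : R) : R :=
  match d with Posz e => pihomog mdeg e p | Negz _ => 0 end.

Fact zpihomogP d p : zhomog d (zpihomog d p).
Proof. by case: d => e //=; apply: pihomogP. Qed.

Fact zpihomogD d : {morph zpihomog d : p q / p + q}.
Proof. by case: d => e p q /=; rewrite ?pihomogD ?addr0. Qed.

Fact zpihomog_id d e p : zhomog e p -> zpihomog d p = if d == e then p else 0.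
Proof.
case: e => e /= hp; last by rewrite hp if_same; case: d => // d; apply: pihomog0.
case: d => d /=; last by [].
have [[->]|/eqP ne] := eqVneq (Posz d) (Posz e); first exact: pihomog_dE.
by apply: (@pihomog_ne0 _ _ _ e) => //; apply/eqP => h; apply: ne; rewrite h.
Qed.

Fact zpihomog_sum (s : seq int) (K : nat) (m : int) p : uniq s ->
  (msize p <= K)%N -> (forall a, (a < K)%N -> m + a%:Z \in s) ->
  \sum_(d <- s) zpihomog (d - m) p = p.
Proof.
move=> us hK hs; rewrite [RHS](pihomog_partitionE hK).
rewrite (eq_bigr (fun d => \sum_(a < K)
   (if d == m + a%:Z then pihomog mdeg a p else 0))); last first.
  move=> d _; rewrite {1}(pihomog_partitionE hK).
  rewrite (big_morph _ (zpihomogD (d - m)) (zpihomog_id _ (zhomog0 0))) ?if_same.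
  apply: eq_bigr => a _.
  by rewrite (@zpihomog_id _ a%:Z) ?subr_eq 1?[_ + m]addrC //; apply: pihomogP.
rewrite exchange_big /=; apply: eq_bigr => a _.
rewrite (bigD1_seq (m + a%:Z)) ?hs //= eqxx big1 ?addr0 // => d ne.
by rewrite (negbTE ne).
Qed.

(* The free module \bigoplus_i R(- deg i). *)
Section FreeModule.
Variables (N : nat) (deg : 'I_N -> int).

Definition free_piece (d : int) (v : 'cV[R]_N) : Prop :=
  forall i, zhomog (d - deg i) (v i 0).

Fact free_piece0 d : free_piece d 0.
Proof. by move=> i; rewrite mxE; apply: zhomog0. Qed.

Fact free_pieceB d x y :
  free_piece d x -> free_piece d y -> free_piece d (x - y).
Proof. by move=> hx hy i; rewrite !mxE; apply: zhomogB. Qed.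

Fact free_pieceZ (e : nat) d (p : R) x :
  p \is e.-homog -> free_piece d x -> free_piece (e%:Z + d) (p *: x).
Proof. by move=> hp hx i; rewrite mxE -addrA; apply: zhomogM. Qed.

Fact free_piece_sum x : exists (s : seq int) (c : int -> 'cV[R]_N),
  [/\ uniq s, forall d, free_piece d (c d) & x = \sum_(d <- s) c d].
Proof.
pose K := \max_i msize (x i 0%R).
exists (undup [seq deg i + a%:Z | i <- enum 'I_N, a <- iota 0 K]).
exists (fun d => \col_i zpihomog (d - deg i) (x i 0)); split.
- exact: undup_uniq.
- by move=> d i; rewrite mxE; apply: zpihomogP.
apply/colP => i; rewrite summxE.
under eq_bigr do rewrite mxE.
rewrite (@zpihomog_sum _ K) ?undup_uniq //; first exact: leq_bigmax.
move=> a ltaK; rewrite mem_undup; apply/allpairsP; exists (i, a).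
by rewrite mem_enum mem_iota.
Qed.

Fact free_piece_direct (s : seq int) (c : int -> 'cV[R]_N) : uniq s ->
  (forall d, free_piece d (c d)) -> \sum_(d <- s) c d = 0 ->
  forall d, d \in s -> c d = 0.
Proof.
move=> us hc sum0 d ds; apply/colP => i; rewrite mxE.
move/colP/(_ i): sum0; rewrite summxE mxE.
move/(congr1 (zpihomog (d - deg i))).
rewrite (big_morph _ (zpihomogD _) (zpihomog_id _ (zhomog0 0))) ?if_same.
under eq_bigr => e _ do rewrite (zpihomog_id _ (hc e i)) (inj_eq (addIr _)).
rewrite (zpihomog_id _ (zhomog0 0)) if_same => <-.
rewrite (bigD1_seq d) //= eqxx big1 ?addr0 // => e ne.
by rewrite eq_sym (negbTE ne).
Qed.

Definition gfree : grmod :=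
  GrMod free_piece0 free_pieceB free_pieceZ free_piece_sum free_piece_direct.
End FreeModule.

Fact ring_piece_sum (x : R^o) : exists (s : seq int) (c : int -> R^o),
  [/\ uniq s, forall d, zhomog d (c d) & x = \sum_(d <- s) c d].
Proof.
exists (map Posz (iota 0 (msize x))), (zpihomog^~ x); split.
- by rewrite map_inj_uniq ?iota_uniq // => a b [].
- by move=> d; apply: zpihomogP.
rewrite -[LHS](@zpihomog_sum (map Posz (iota 0 (msize x))) (msize x) 0) //.
- by apply: eq_bigr => d _; rewrite subr0.
- by rewrite map_inj_uniq ?iota_uniq // => a b [].
by move=> a lta; rewrite add0r map_f // mem_iota.
Qed.

Fact ring_piece_direct (s : seq int) (c : int -> R^o) : uniq s ->
  (forall d, zhomog d (c d)) -> \sum_(d <- s) c d = 0 ->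
  forall d, d \in s -> c d = 0.
Proof.
move=> us hc /(congr1 (zpihomog _)) + d ds => /(_ d).
rewrite (big_morph _ (zpihomogD _) (zpihomog_id _ (zhomog0 0))) ?if_same.
under eq_bigr => e _ do rewrite (zpihomog_id _ (hc e)).
rewrite (zpihomog_id _ (zhomog0 0)) if_same => <-.
rewrite (bigD1_seq d) //= eqxx big1 ?addr0 // => e ne.
by rewrite eq_sym (negbTE ne).
Qed.

Definition gring : grmod :=
  @GrMod R^o zhomog zhomog0 zhomogB zhomogM ring_piece_sum ring_piece_direct.

Section Kernel.
Variables (M N : grmod) (f : grhom M N).

Definition ker_piece (d : int) (x : ker_mod f) : Prop := gpiece d (val x).

Fact ker_piece_sum (x : ker_mod f) : exists (s : seq int) (c : int -> ker_mod f),
  [/\ uniq s, forall d, ker_piece d (c d) & x = \sum_(d <- s) c d].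
Proof.
have [s [c [us hc xE]]] := gpiece_sum (val x).
have fc d : d \in s -> c d \in lker f.
  move=> ds; rewrite inE; apply/eqP.
  apply: (gpiece_direct us (c := fun d => f (c d))) ds.
    by move=> e; apply/ghom_deg/hc.
  by rewrite -linear_sum -xE; apply/eqP/(valP x).
exists s, (fun d => insubd 0 (c d)); split=> //.
  move=> d; rewrite /ker_piece val_insubd; case: ifP => // _.
  exact: gpiece0.
apply: val_inj; rewrite linear_sum /= xE !big_seq.
by apply: eq_bigr => d ds; rewrite insubdK //; apply: fc.
Qed.

Fact ker_piece_direct (s : seq int) (c : int -> ker_mod f) : uniq s ->
  (forall d, ker_piece d (c d)) -> \sum_(d <- s) c d = 0 ->
  forall d, d \in s -> c d = 0.
Proof.
move=> us hc /(congr1 val); rewrite linear_sum linear0 => sum0 d ds.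
by apply: val_inj; rewrite (gpiece_direct us hc sum0 ds) linear0.
Qed.

Definition gker : grmod :=
  @GrMod (ker_mod f) ker_piece
    (fun d => gpiece0 _ d)
    (fun d x y hx hy => gpieceB hx hy)
    (fun e d p x hp hx => gpieceZ hp hx)
    ker_piece_sum ker_piece_direct.
End Kernel.

End GradedModules.

Fact gpieceD (k : fieldType) (n : nat) (M : grmod k n) d (x y : M) :
  gpiece d x -> gpiece d y -> gpiece d (x + y).
Proof.
move=> hx hy; rewrite -[y]opprK; apply: gpieceB => //.
by rewrite -sub0r; apply: gpieceB => //; apply: gpiece0.
Qed.

Fact scale_opp_eq0 (A : pzRingType) (V : lmodType A) (h f g : A) (x y : V) :
  h *: (f *: x - g *: y) = 0 -> h *: (f *: - x - g *: - y) = 0.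
Proof. by move=> E; rewrite !scalerN -opprD scalerN E oppr0. Qed.

Section Proj.
Variables (k : fieldType) (n : nat).
Local Notation R := {mpoly k[n.+1]}.

(* Points of Proj R: the last field says that (x_0, ..., x_n) is not contained
   in the ideal; in particular the ideal is proper. *)
Record point := Point {
  pideal :> R -> Prop;
  pideal0 : pideal 0;
  pidealD : forall f g, pideal f -> pideal g -> pideal (f + g);
  pidealM : forall f g, pideal g -> pideal (f * g);
  pideal_prime : forall f g, pideal (f * g) -> pideal f \/ pideal g;
  pideal_homog : forall f d, pideal f -> pideal (pihomog mdeg d f);
  pideal_relevant : exists i : 'I_n.+1, ~ pideal 'X_i
}.

Fact pidealNM (p : point) f g : ~ p f -> ~ p g -> ~ p (f * g).
Proof. by move=> pf pg /pideal_prime[]. Qed.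

Fact pidealN1 (p : point) : ~ p 1.
Proof.
have [i pi] := pideal_relevant p => p1; apply: pi.
by rewrite -[X in pideal _ X]mulr1; apply: pidealM.
Qed.

(* Zariski topology: the open sets are the complements of the zero loci of
   sets of homogeneous polynomials. *)
Definition zariski_open (U : point -> Prop) : Prop :=
  exists S : R -> Prop, (forall f, S f -> exists d, f \is d.-homog) /\
    forall p : point, U p <-> exists2 f, S f & ~ p f.

Record zopen := ZOpen {
  zset :> point -> Prop;
  zsetP : zariski_open zset
}.

Definition zsub (V U : zopen) : Prop := forall p, V p -> U p.
Local Notation "V <<= U" := (zsub V U) (at level 70).

Fact zsub_refl U : U <<= U. Proof. by []. Qed.

Fact zsub_trans W V U : W <<= V -> V <<= U -> W <<= U.
Proof. by move=> WV VU p /WV /VU. Qed.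

Fact zfull_open : zariski_open (fun=> True).
Proof.
exists (fun f => f = 1); split=> [_ ->|p]; first by exists 0%N; apply: dhomog1.
by split=> // _; exists 1 => //; apply: pidealN1.
Qed.
Definition zfull : zopen := ZOpen zfull_open.

Fact zinter_open (U V : zopen) : zariski_open (fun p => U p /\ V p).
Proof.
have [S [hS US]] := zsetP U; have [T [hT VT]] := zsetP V.
exists (fun h => exists f g, [/\ S f, T g & h = f * g]); split=> [_ [f [g [Sf Tg ->]]]|p].
  have [[d hf] [e hg]] := (hS _ Sf, hT _ Tg).
  by exists (d + e)%N; apply: dhomogM.
split=> [[/US[f Sf pf] /VT[g Tg pg]]|[_ [f [g [Sf Tg ->]]] pfg]].
  by exists (f * g); [exists f, g | apply: pidealNM].
split; [apply/US; exists f => // | apply/VT; exists g => //] => h; apply: pfg.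
  by rewrite mulrC; apply: pidealM.
exact: pidealM.
Qed.
Definition zinter (U V : zopen) : zopen := ZOpen (zinter_open U V).

Fact zinterl U V : zinter U V <<= U. Proof. by move=> p []. Qed.
Fact zinterr U V : zinter U V <<= V. Proof. by move=> p []. Qed.

(* The stalk M_(p): the degree 0 part of the localization of M at the
   homogeneous elements of R outside p. *)
Section Stalk.
Variables (M : grmod k n) (p : point).

Record frac := Frac {
  fnum : M;
  fden : R;
  fdeg : nat;
  fnumP : gpiece fdeg%:Z fnum;
  fdenP : fden \is fdeg.-homog;
  fdenN : ~ p fden
}.
HB.instance Definition _ := gen_eqMixin frac.
HB.instance Definition _ := gen_choiceMixin frac.

Definition frac_eqv (a b : frac) : Prop :=
  exists h e, [/\ h \is e.-homog, ~ p h &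
    h *: (fden b *: fnum a - fden a *: fnum b) = 0].

Definition frac_eqvb : rel frac := fun a b => `[< frac_eqv a b >].

Fact frac_eqv_refl : reflexive frac_eqvb.
Proof.
move=> a; apply/asboolP; exists 1, 0%N; split; first exact: dhomog1.
  exact: pidealN1.
by rewrite subrr scaler0.
Qed.

Fact frac_eqv_sym : ssrbool.symmetric frac_eqvb.
Proof.
suff s a b : frac_eqvb a b -> frac_eqvb b a by move=> a b; apply/idP/idP => /s.
move=> /asboolP[h [e [hh ph eq]]]; apply/asboolP; exists h, e; split=> //.
by rewrite -opprB scalerN eq oppr0.
Qed.

Fact frac_eqv_trans : transitive frac_eqvb.
Proof.
move=> b a c /asboolP[h [e [hh ph E1]]] /asboolP[g [d [hg pg E2]]].
apply/asboolP; exists (h * g * fden b), (e + d + fdeg b)%N; split.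
- by rewrite !dhomogM // fdenP.
- by do 2?apply: pidealNM => //; apply: fdenN.
transitivity (g * fden c *: (h *: (fden b *: fnum a - fden a *: fnum b))
  + h * fden a *: (g *: (fden c *: fnum b - fden b *: fnum c))).
  rewrite !scalerBr !scalerA addrA; congr (_ - _); last first.
    by congr (_ *: _); ring.
  by rewrite -addrA -[LHS]addr0; congr (_ *: _ + _); [ring|
    apply/esym/eqP; rewrite addrC subr_eq0; apply/eqP; congr (_ *: _); ring].
by rewrite E1 E2 !scaler0 addr0.
Qed.

Canonical frac_equiv_rel :=
  EquivRel frac_eqvb frac_eqv_refl frac_eqv_sym frac_eqv_trans.

Definition stalk : Type := {eq_quot frac_eqvb}.
HB.instance Definition _ := Choice.on stalk.
HB.instance Definition _ := EqQuotient.on stalk.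

Definition germ (a : frac) : stalk := \pi_stalk a.

Fact germ_eq a b : germ a = germ b <-> frac_eqv a b.
Proof.
split=> [/eqmodP|h]; first by move=> /asboolP.
by apply/eqmodP/asboolP.
Qed.

Fact germK s : germ (repr s) = s. Proof. exact: reprK. Qed.

Fact germ_eqW a b : fden b *: fnum a = fden a *: fnum b -> germ a = germ b.
Proof.
move=> E; apply/germ_eq; exists 1, 0%N; split; first exact: dhomog1.
  exact: pidealN1.
by rewrite E subrr scaler0.
Qed.

Fact zero_subproof : gpiece 0%:Z (0 : M). Proof. exact: gpiece0. Qed.
Fact one_subproof : (1 : R) \is 0.-homog. Proof. exact: dhomog1. Qed.
Definition fzero := Frac zero_subproof one_subproof (@pidealN1 p).

Fact add_subproof (a b : frac) :
  gpiece (fdeg a + fdeg b)%N%:Z (fden b *: fnum a + fden a *: fnum b).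
Proof.
apply: gpieceD; last by rewrite PoszD; apply: gpieceZ (fdenP a) (fnumP b).
by rewrite addnC PoszD; apply: gpieceZ (fdenP b) (fnumP a).
Qed.
Definition fadd (a b : frac) := Frac (add_subproof a b)
  (dhomogM (fdenP a) (fdenP b)) (pidealNM (@fdenN a) (@fdenN b)).

Fact opp_subproof (a : frac) : gpiece (fdeg a)%:Z (- fnum a).
Proof. by rewrite -sub0r; apply: gpieceB (fnumP a); apply: gpiece0. Qed.
Definition fopp (a : frac) := Frac (opp_subproof a) (fdenP a) (@fdenN a).

Definition stalk_add (s t : stalk) := germ (fadd (repr s) (repr t)).
Definition stalk_opp (s : stalk) := germ (fopp (repr s)).

Fact germD a b : stalk_add (germ a) (germ b) = germ (fadd a b).
Proof.
have /germ_eq[h [e [hh ph E1]]] := germK (germ a).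
have /germ_eq[g [d [hg pg E2]]] := germK (germ b).
rewrite /stalk_add; move: (repr (germ a)) (repr (germ b)) E1 E2 => a' b' E1 E2.
apply/germ_eq; exists (h * g), (e + d)%N; split.
- exact: dhomogM.
- exact: pidealNM.
transitivity ((g * fden b * fden b') *: (h *: (fden a *: fnum a' - fden a' *: fnum a))
  + (h * fden a * fden a') *: (g *: (fden b *: fnum b' - fden b' *: fnum b))).
  rewrite /= !scalerBr !scalerDr !scalerA opprD addrACA.
  by congr (_ - _ + (_ - _)); congr (_ *: _); ring.
by rewrite E1 E2 !scaler0 addr0.
Qed.

Fact germN a : stalk_opp (germ a) = germ (fopp a).
Proof.
have /germ_eq[h [e [hh ph E1]]] := germK (germ a).
apply/germ_eq; exists h, e; split=> //.
exact: scale_opp_eq0.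
Qed.

Fact stalk_addA : associative stalk_add.
Proof.
move=> s t u; rewrite -[s]germK -[t]germK -[u]germK !germD; apply: germ_eqW.
rewrite /= !scalerDr !scalerA addrA.
by congr (_ + _ + _); congr (_ *: _); ring.
Qed.

Fact stalk_addC : commutative stalk_add.
Proof.
move=> s t; rewrite -[s]germK -[t]germK !germD; apply: germ_eqW.
rewrite /= !scalerDr !scalerA addrC.
by congr (_ + _); congr (_ *: _); ring.
Qed.

Fact stalk_add0 : left_id (germ fzero) stalk_add.
Proof.
move=> s; rewrite -[s]germK !germD; apply: germ_eqW.
by rewrite /= !scaler0 add0r scale1r mul1r.
Qed.

Fact stalk_addN : left_inverse (germ fzero) stalk_opp stalk_add.
Proof.
move=> s; rewrite -[s]germK germN !germD; apply: germ_eqW.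
by rewrite /= scalerN addNr !scaler0.
Qed.

HB.instance Definition _ := GRing.isZmodule.Build stalk
  stalk_addA stalk_addC stalk_add0 stalk_addN.

(* s is the class of x / f. *)
Definition is_frac (s : stalk) (x : M) (f : R) : Prop :=
  exists a : frac, [/\ s = germ a, fnum a = x & fden a = f].

Fact is_frac0 : is_frac 0 0 1.
Proof. by exists fzero. Qed.

Fact is_fracD s t x y f g :
  is_frac s x f -> is_frac t y g -> is_frac (s + t) (g *: x + f *: y) (f * g).
Proof.
by move=> [a [-> <- <-]] [b [-> <- <-]]; exists (fadd a b); split=> //; apply: germD.
Qed.

Fact is_fracN s x f : is_frac s x f -> is_frac (- s) (- x) f.
Proof. by move=> [a [-> <- <-]]; exists (fopp a); split=> //; apply: germN. Qed.

End Stalk.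

Section StalkScale.
Variables (M : grmod k n) (p : point).

Fact scale_subproof (a : frac (gring k n) p) (b : frac M p) :
  gpiece (fdeg a + fdeg b)%N%:Z ((fnum a : R) *: fnum b).
Proof. by rewrite PoszD; apply: gpieceZ (fnumP a) (fnumP b). Qed.

Definition fscale (a : frac (gring k n) p) (b : frac M p) : frac M p :=
  Frac (scale_subproof a b)
    (dhomogM (fdenP a) (fdenP b)) (pidealNM (@fdenN _ _ a) (@fdenN _ _ b)).

Definition stalk_scale (s : stalk (gring k n) p) (t : stalk M p) : stalk M p :=
  germ (fscale (repr s) (repr t)).

Fact germZ a b : stalk_scale (germ a) (germ b) = germ (fscale a b).
Proof.
have /germ_eq[h [e [hh ph E1]]] := germK (germ a).
have /germ_eq[g [d [hg pg E2]]] := germK (germ b).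
rewrite /stalk_scale; move: (repr (germ a)) (repr (germ b)) E1 E2 => a' b' E1 E2.
apply/germ_eq; exists (h * g), (e + d)%N; split.
- exact: dhomogM.
- exact: pidealNM.
have {}E1 : h * (fden a * fnum a' - fden a' * fnum a) = 0 by [].
transitivity ((h * (fden a * fnum a' - fden a' * fnum a) * (g * fden b)) *: fnum b'
  + (h * fden a' * fnum a) *: (g *: (fden b *: fnum b' - fden b' *: fnum b))).
  rewrite /= !scalerBr !scalerA addrA; congr (_ - _); last first.
    by congr (_ *: _); ring.
  by rewrite -scalerDl; congr (_ *: _); ring.
by rewrite E1 E2 !mul0r scale0r scaler0 addr0.
Qed.

Fact is_fracZ s t a f x g :
  is_frac s a f -> is_frac t x g -> is_frac (stalk_scale s t) ((a : R) *: x) (f * g).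
Proof.
move=> [a' [-> <- <-]] [b [-> <- <-]]; exists (fscale a' b); split=> //.
exact: germZ.
Qed.

Definition stalk_one : stalk (gring k n) p :=
  germ (@Frac (gring k n) p 1 1 0 (one_subproof) (one_subproof) (@pidealN1 p)).

Fact stalk_scale1 (s : stalk M p) : stalk_scale stalk_one s = s.
Proof.
rewrite -[s]germK germZ; apply: germ_eqW.
by rewrite /= !scale1r mul1r.
Qed.

Fact stalk_scaleDr s : {morph stalk_scale s : t u / t + u}.
Proof.
move=> t u; rewrite -[s]germK -[t]germK -[u]germK [_ + _]germD !germZ.
rewrite [RHS]germD; apply: germ_eqW.
rewrite /= !scalerDr !scalerA.
by congr (_ + _); congr (_ *: _); ring.
Qed.

Fact stalk_scaleDl t : {morph stalk_scale^~ t : s u / s + u}.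
Proof.
move=> s u; rewrite -[s]germK -[t]germK -[u]germK [X in stalk_scale X]germD !germZ.
rewrite [RHS]germD; apply: germ_eqW.
rewrite /= !scalerDr !scalerA -scalerDl; congr (_ *: _).
by rewrite /GRing.scale /=; ring.
Qed.
End StalkScale.

Fact stalk_scaleA (M : grmod k n) p (s t : stalk (gring k n) p) (u : stalk M p) :
  stalk_scale s (stalk_scale t u) = stalk_scale (stalk_scale s t) u.
Proof.
rewrite -[s]germK -[t]germK -[u]germK !germZ; apply: germ_eqW.
by rewrite /= !scalerA; congr (_ *: _); rewrite /GRing.scale /=; ring.
Qed.

Fact stalk_scaleC p (s t : stalk (gring k n) p) : stalk_scale s t = stalk_scale t s.
Proof.
rewrite -[s]germK -[t]germK !germZ; apply: germ_eqW.
by rewrite /= /GRing.scale /=; ring.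
Qed.

HB.instance Definition _ p := GRing.Zmodule_isComPzRing.Build
  (stalk (gring k n) p) (@stalk_scaleA (gring k n) p) (@stalk_scaleC p)
  (@stalk_scale1 (gring k n) p) (fun s t u => @stalk_scaleDl (gring k n) p u s t).

HB.instance Definition _ M p := GRing.Zmodule_isLmodule.Build
  (stalk (gring k n) p) (stalk M p) (@stalk_scaleA M p) (@stalk_scale1 M p)
  (@stalk_scaleDr M p) (@stalk_scaleDl M p).

Definition zpt (U : zopen) : Type := {p : point | U p}.

Definition zincl (V U : zopen) (VU : V <<= U) (q : zpt V) : zpt U :=
  exist _ (sval q) (VU _ (svalP q)).

(* Sections of the sheaf associated with M over U, as in Hartshorne, II.5. *)
Section Sections.
Variables (M : grmod k n) (U : zopen).

Definition locally_frac (s : forall q : zpt U, stalk M (sval q)) : Prop :=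
  forall q : zpt U, exists (V : zopen) (x : M) (f : R), V (sval q) /\
    forall q' : zpt U, V (sval q') -> is_frac (s q') x f.

Record sect := Sect {
  sfun :> forall q : zpt U, stalk M (sval q);
  sfunP : locally_frac sfun
}.
HB.instance Definition _ := gen_eqMixin sect.
HB.instance Definition _ := gen_choiceMixin sect.

Fact sect_eq (s t : sect) : (forall q, s q = t q) -> s = t.
Proof.
case: s t => [s sP] [t tP] /= st.
have {}st : s = t by apply: functional_extensionality_dep.
by case: t / st tP => tP; congr Sect; apply: Prop_irrelevance.
Qed.

Fact sect_irr (s : sect) q (h h' : U q) : s (exist _ q h) = s (exist _ q h').
Proof. by rewrite (Prop_irrelevance h h'). Qed.

Fact sect0_subproof : locally_frac (fun=> 0).
Proof. by move=> q; exists zfull, 0, 1; split=> // q' _; apply: is_frac0. Qed.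
Definition sect0 := Sect sect0_subproof.

Fact sectD_subproof (s t : sect) : locally_frac (fun q => s q + t q).
Proof.
move=> q; have [V [x [f [Vq sx]]]] := sfunP s q.
have [W [y [g [Wq ty]]]] := sfunP t q.
exists (zinter V W), (g *: x + f *: y), (f * g); split=> // q' [Vq' Wq'].
by apply: is_fracD; [apply: sx | apply: ty].
Qed.
Definition sectD s t := Sect (sectD_subproof s t).

Fact sectN_subproof (s : sect) : locally_frac (fun q => - s q).
Proof.
move=> q; have [V [x [f [Vq sx]]]] := sfunP s q.
by exists V, (- x), f; split=> // q' Vq'; apply/is_fracN/sx.
Qed.
Definition sectN s := Sect (sectN_subproof s).

Fact sectA : associative sectD.
Proof. by move=> s t u; apply: sect_eq => q /=; rewrite addrA. Qed.
Fact sectC : commutative sectD.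
Proof. by move=> s t; apply: sect_eq => q /=; rewrite addrC. Qed.
Fact sect0D : left_id sect0 sectD.
Proof. by move=> s; apply: sect_eq => q /=; rewrite add0r. Qed.
Fact sectND : left_inverse sect0 sectN sectD.
Proof. by move=> s; apply: sect_eq => q /=; rewrite addNr. Qed.
HB.instance Definition _ := GRing.isZmodule.Build sect sectA sectC sect0D sectND.
End Sections.

Definition OX (U : zopen) : Type := sect (gring k n) U.
HB.instance Definition _ U := GRing.Zmodule.on (OX U).

Section SectionScale.
Variables (M : grmod k n) (U : zopen).

Fact sectZ_subproof (a : OX U) (s : sect M U) :
  locally_frac (fun q => stalk_scale (a q) (s q)).
Proof.
move=> q; have [V [x [f [Vq sx]]]] := sfunP a q.
have [W [y [g [Wq ty]]]] := sfunP s q.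
exists (zinter V W), ((x : R) *: y), (f * g); split=> // q' [Vq' Wq'].
by apply: is_fracZ; [apply: sx | apply: ty].
Qed.
Definition sectZ (a : OX U) (s : sect M U) : sect M U :=
  Sect (sectZ_subproof a s).

Fact sect1_subproof :
  locally_frac (fun q : zpt U => 1 : stalk (gring k n) (sval q)).
Proof.
move=> q; exists zfull, 1, 1; split=> // q' _.
by exists (@Frac (gring k n) (sval q') 1 1 0 one_subproof one_subproof
  (@pidealN1 (sval q'))).
Qed.
Definition sect1 : OX U := Sect sect1_subproof.

Fact sectZ1 : left_id sect1 sectZ.
Proof. by move=> s; apply: sect_eq => q; apply: stalk_scale1. Qed.
Fact sectZDr a : {morph sectZ a : s t / s + t}.
Proof. by move=> s t; apply: sect_eq => q; apply: stalk_scaleDr. Qed.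
Fact sectZDl s : {morph sectZ^~ s : a b / a + b}.
Proof. by move=> a b; apply: sect_eq => q; apply: stalk_scaleDl. Qed.
End SectionScale.

Fact sectZA M U (a b : OX U) (s : sect M U) :
  sectZ a (sectZ b s) = sectZ (sectZ a b) s.
Proof. by apply: sect_eq => q; apply: stalk_scaleA. Qed.
Fact sectZC U (a b : OX U) : sectZ a b = sectZ b a.
Proof. by apply: sect_eq => q; apply: stalk_scaleC. Qed.

HB.instance Definition _ U := GRing.Zmodule_isComPzRing.Build (OX U)
  (@sectZA (gring k n) U) (@sectZC U) (@sectZ1 (gring k n) U)
  (fun a b c => @sectZDl (gring k n) U c a b).

HB.instance Definition _ M U := GRing.Zmodule_isLmodule.Build
  (OX U) (sect M U) (@sectZA M U) (@sectZ1 M U) (@sectZDr M U) (@sectZDl M U).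

Fact sres_subproof M (U V : zopen) (VU : V <<= U) (s : sect M U) :
  locally_frac (fun q => s (zincl VU q)).
Proof.
move=> q; have [W [x [f [Wq sx]]]] := sfunP s (zincl VU q).
by exists W, x, f; split=> // q' Wq'; apply: (sx (zincl VU q')).
Qed.
Definition sres M (U V : zopen) (VU : V <<= U) (s : sect M U) : sect M V :=
  Sect (sres_subproof VU s).
Definition OX_res (U V : zopen) (VU : V <<= U) (a : OX U) : OX V :=
  sres VU a.

Record omod := OMod {
  osec :> forall U : zopen, lmodType (OX U);
  ores : forall U V : zopen, V <<= U -> osec U -> osec V;
  ores_lin : forall U V (VU : V <<= U) a s t,
    ores VU (a *: s + t) = OX_res VU a *: ores VU s + ores VU t;
  ores_id : forall U (UU : U <<= U) s, ores UU s = s;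
  ores_comp : forall U V W (VU : V <<= U) (WV : W <<= V) (WU : W <<= U) s,
    ores WV (ores VU s) = ores WU s;
  ores_sep : forall U (I : Type) (C : I -> zopen) (CU : forall i, C i <<= U),
    (forall p, U p -> exists i, C i p) ->
    forall s t : osec U, (forall i, ores (CU i) s = ores (CU i) t) -> s = t;
  ores_glue : forall U (I : Type) (C : I -> zopen) (CU : forall i, C i <<= U),
    (forall p, U p -> exists i, C i p) ->
    forall s : forall i, osec (C i),
    (forall i j, ores (@zinterl (C i) (C j)) (s i)
               = ores (@zinterr (C i) (C j)) (s j)) ->
    exists t : osec U, forall i, ores (CU i) t = s i
}.

Record omor (A B : omod) := OMor {
  omap : forall U, {linear A U -> B U};
  omap_res : forall U V (VU : V <<= U) s,
    omap V (ores VU s) = ores VU (omap U s)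
}.

Definition iso_on (W : zopen) (A B : omod) : Prop :=
  exists phi : forall V, V <<= W -> {linear A V -> B V},
    (forall V (VW : V <<= W), bijective (phi V VW)) /\
    (forall U V (UW : U <<= W) (VW : V <<= W) (VU : V <<= U) s,
      phi V VW (ores VU s) = ores VU (phi U UW s)).

Definition isomorphic (A B : omod) : Prop := iso_on zfull A B.

Section Sheafify.
Variable M : grmod k n.

Fact sres_lin U V (VU : V <<= U) (a : OX U) (s t : sect M U) :
  sres VU (a *: s + t) = OX_res VU a *: sres VU s + sres VU t.
Proof. by apply: sect_eq => q. Qed.

Fact sres_id U (UU : U <<= U) (s : sect M U) : sres UU s = s.
Proof.
by apply: sect_eq => -[q Uq]; rewrite /= /zincl /=; apply: sect_irr.
Qed.

Fact sres_comp U V W (VU : V <<= U) (WV : W <<= V) (WU : W <<= U) (s : sect M U) :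
  sres WV (sres VU s) = sres WU s.
Proof.
by apply: sect_eq => -[q Wq]; rewrite /= /zincl /=; apply: sect_irr.
Qed.

Fact sres_sep U (I : Type) (C : I -> zopen) (CU : forall i, C i <<= U) :
  (forall p, U p -> exists i, C i p) ->
  forall s t : sect M U, (forall i, sres (CU i) s = sres (CU i) t) -> s = t.
Proof.
move=> cov s t st; apply: sect_eq => -[p Up]; have [i Cp] := cov _ Up.
have /= := congr1 (fun u : sect M (C i) => u (exist _ p Cp)) (st i).
by rewrite /zincl /= !(sect_irr _ _ Up).
Qed.

Fact sres_glue U (I : Type) (C : I -> zopen) (CU : forall i, C i <<= U) :
  (forall p, U p -> exists i, C i p) ->
  forall s : forall i, sect M (C i),
  (forall i j, sres (@zinterl (C i) (C j)) (s i)
             = sres (@zinterr (C i) (C j)) (s j)) ->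
  exists t : sect M U, forall i, sres (CU i) t = s i.
Proof.
move=> cov s agree.
pose idx (q : zpt U) := sval (cid (cov _ (svalP q))).
have idxP (q : zpt U) : C (idx q) (sval q) := svalP (cid (cov _ (svalP q))).
pose t (q : zpt U) : stalk M (sval q) := s (idx q) (exist _ (sval q) (idxP q)).
have tE i q (Uq : U q) (Cq : C i q) : t (exist _ q Uq) = s i (exist _ q Cq).
  rewrite /t /=; move: (idxP _) => /=; move: (idx _) => j Cj.
  have /= := congr1 (fun u : sect M (zinter (C j) (C i)) => u (exist _ q (conj Cj Cq))) (agree j i).
  by rewrite /zincl /= (sect_irr _ _ Cj) (sect_irr _ _ Cq).
have tP : locally_frac t.
  move=> q; have [W [x [f [Wq sx]]]] := sfunP (s (idx q)) (exist _ _ (idxP q)).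
  exists (zinter W (C (idx q))), x, f; split=> [|[q' Uq'] [Wq' Cq']].
    by split=> //; apply: idxP.
  by rewrite (tE _ _ _ Cq'); apply: (sx (exist _ q' Cq')).
exists (Sect tP) => i; apply: sect_eq => -[q Cq] /=.
exact: tE.
Qed.

Definition sheafify : omod :=
  @OMod (fun U => sect M U) (@sres M) sres_lin sres_id sres_comp sres_sep sres_glue.
End Sheafify.

(* The morphism of sheaves induced by mu : M -> N sends x / f to mu x / f. *)
Section SheafifyMorphism.
Variables (M N : grmod k n) (mu : grhom M N).

Definition frac_map p (a : frac M p) : frac N p :=
  Frac (ghom_deg mu (fnumP a)) (fdenP a) (@fdenN _ _ a).

Definition stalk_map p (s : stalk M p) : stalk N p := germ (frac_map (repr s)).

Fact germ_map p (a : frac M p) : stalk_map (germ a) = germ (frac_map a).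
Proof.
have /germ_eq[h [e [hh ph E]]] := germK (germ a).
apply/germ_eq; exists h, e; split=> //=.
by rewrite -!linearZ -linearB -linearZ E linear0.
Qed.

Fact is_frac_map p (s : stalk M p) x f :
  is_frac s x f -> is_frac (stalk_map s) (mu x) f.
Proof.
by move=> [a [-> <- <-]]; exists (frac_map a); split=> //; apply: germ_map.
Qed.

Fact stalk_mapD p : {morph @stalk_map p : s t / s + t}.
Proof.
move=> s t; rewrite -[s]germK -[t]germK [_ + _]germD !germ_map [RHS]germD.
by apply: germ_eqW; rewrite /= linearD !linearZ.
Qed.

Fact stalk_mapZ p (a : stalk (gring k n) p) s :
  stalk_map (stalk_scale a s) = stalk_scale a (stalk_map s).
Proof.
rewrite -[a]germK -[s]germK germZ !germ_map germZ.
by apply: germ_eqW; rewrite /= linearZ.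
Qed.

Section Map.
Variable U : zopen.

Fact sect_map_subproof (s : sect M U) : locally_frac (fun q => stalk_map (s q)).
Proof.
move=> q; have [V [x [f [Vq sx]]]] := sfunP s q.
by exists V, (mu x), f; split=> // q' Vq'; apply/is_frac_map/sx.
Qed.
Definition sect_map (s : sect M U) : sect N U := Sect (sect_map_subproof s).

Fact sect_map_linear : linear sect_map.
Proof.
move=> a s t; apply: sect_eq => q /=.
by rewrite stalk_mapD; congr (_ + _); apply: stalk_mapZ.
Qed.
HB.instance Definition _ :=
  GRing.isLinear.Build (OX U) (sect M U) (sect N U) _ sect_map sect_map_linear.
End Map.

Fact sect_map_res U V (VU : V <<= U) (s : sect M U) :
  sect_map (sres VU s) = sres VU (sect_map s).
Proof. by apply: sect_eq => q. Qed.

Definition sheafify_mor : omor (sheafify M) (sheafify N) :=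
  @OMor (sheafify M) (sheafify N) (fun U => @sect_map U) sect_map_res.
End SheafifyMorphism.

Section FreeSheaf.
Variable r : nat.

Definition fres U V (VU : V <<= U) (s : 'cV[OX U]_r) : 'cV[OX V]_r :=
  \col_i sres VU (s i 0).

Fact fres_lin U V (VU : V <<= U) (a : OX U) s t :
  fres VU (a *: s + t) = OX_res VU a *: fres VU s + fres VU t.
Proof. by apply/colP => i; rewrite !mxE; apply: sres_lin. Qed.

Fact fres_id U (UU : U <<= U) s : fres UU s = s.
Proof. by apply/colP => i; rewrite !mxE sres_id. Qed.

Fact fres_comp U V W (VU : V <<= U) (WV : W <<= V) (WU : W <<= U) s :
  fres WV (fres VU s) = fres WU s.
Proof. by apply/colP => i; rewrite !mxE; apply: sres_comp. Qed.

Fact fres_sep U (I : Type) (C : I -> zopen) (CU : forall i, C i <<= U) :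
  (forall p, U p -> exists i, C i p) ->
  forall s t : 'cV[OX U]_r,
  (forall i, fres (CU i) s = fres (CU i) t) -> s = t.
Proof.
move=> cov s t st; apply/colP => j; apply: (sres_sep (CU := CU) cov) => i.
by have /colP/(_ j) := st i; rewrite !mxE.
Qed.

Fact fres_glue U (I : Type) (C : I -> zopen) (CU : forall i, C i <<= U) :
  (forall p, U p -> exists i, C i p) ->
  forall s : forall i, 'cV[OX (C i)]_r,
  (forall i j, fres (@zinterl (C i) (C j)) (s i)
             = fres (@zinterr (C i) (C j)) (s j)) ->
  exists t : 'cV[OX U]_r, forall i, fres (CU i) t = s i.
Proof.
move=> cov s agree.
have tj j : exists t : OX U, forall i, sres (CU i) t = s i j 0.
  apply: (sres_glue CU cov) => i i'.
  by have /colP/(_ j) := agree i i'; rewrite !mxE.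
exists (\col_j sval (cid (tj j))) => i; apply/colP => j; rewrite !mxE.
exact: (svalP (cid (tj j)) i).
Qed.

Definition ofree : omod :=
  @OMod (fun U => 'cV[OX U]_r) fres fres_lin fres_id fres_comp
    fres_sep fres_glue.
End FreeSheaf.

Definition vector_bundle (r : nat) (A : omod) : Prop :=
  forall p : point, exists2 W : zopen, W p & iso_on W A (ofree r).

Section KernelSheaf.
Variables (A B : omod) (phi : omor A B).

Fact ores0 (D : omod) U V (VU : V <<= U) : ores VU (0 : D U) = 0.
Proof.
have := ores_lin VU 1 (0 : D U) 0.
have -> : OX_res VU 1 = 1 by apply: sect_eq.
rewrite !scale1r addr0 => E.
by apply: (addrI (ores VU (0 : D U))); rewrite -E addr0.
Qed.

Fact kres_subproof U V (VU : V <<= U) (s : ker_mod (omap phi U)) :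
  ores VU (val s) \in lker (omap phi V).
Proof. by have /eqP E := valP s; rewrite inE omap_res E ores0. Qed.

Definition kres U V (VU : V <<= U) (s : ker_mod (omap phi U)) :
  ker_mod (omap phi V) := Sub (ores VU (val s)) (kres_subproof VU s).

Fact kres_lin U V (VU : V <<= U) (a : OX U) s t :
  kres VU (a *: s + t) = OX_res VU a *: kres VU s + kres VU t.
Proof. by apply: val_inj; rewrite /= ores_lin. Qed.

Fact kres_id U (UU : U <<= U) s : kres UU s = s.
Proof. by apply: val_inj; rewrite /= ores_id. Qed.

Fact kres_comp U V W (VU : V <<= U) (WV : W <<= V) (WU : W <<= U) s :
  kres WV (kres VU s) = kres WU s.
Proof. by apply: val_inj; rewrite /= (ores_comp _ _ WU). Qed.

Fact kres_sep U (I : Type) (C : I -> zopen) (CU : forall i, C i <<= U) :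
  (forall p, U p -> exists i, C i p) ->
  forall s t : ker_mod (omap phi U),
  (forall i, kres (CU i) s = kres (CU i) t) -> s = t.
Proof.
move=> cov s t st; apply: val_inj; apply: (ores_sep (CU := CU) cov) => i.
exact: (congr1 val (st i)).
Qed.

Fact kres_glue U (I : Type) (C : I -> zopen) (CU : forall i, C i <<= U) :
  (forall p, U p -> exists i, C i p) ->
  forall s : forall i, ker_mod (omap phi (C i)),
  (forall i j, kres (@zinterl (C i) (C j)) (s i)
             = kres (@zinterr (C i) (C j)) (s j)) ->
  exists t : ker_mod (omap phi U), forall i, kres (CU i) t = s i.
Proof.
move=> cov s agree.
have [t tE] : exists t : A U, forall i, ores (CU i) t = val (s i).
  by apply: (ores_glue CU cov) => i j; apply: (congr1 val (agree i j)).
have tK : t \in lker (omap phi U).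
  rewrite inE; apply/eqP; apply: (ores_sep (CU := CU) cov) => i.
  by rewrite -omap_res tE ores0; apply/eqP/(valP (s i)).
by exists (Sub t tK) => i; apply: val_inj; rewrite /= tE.
Qed.

Definition oker : omod :=
  @OMod (fun U => ker_mod (omap phi U)) kres kres_lin kres_id kres_comp
    kres_sep kres_glue.
End KernelSheaf.

End Proj.

Section Resolutions.
Variables (k : fieldType) (n : nat).
Local Notation R := {mpoly k[n.+1]}.

(* All coordinates of v lie in the irrelevant ideal (x_0, ..., x_n). *)
Definition irrelevant_entries N (v : 'cV[R]_N) : Prop :=
  forall i, (v i 0)@_0%MM = 0.

(* M^i is gfree (rdeg i), and rd i is the differential M^(i+1) -> M^i. *)
Record minres (M : grmod k n) := MinRes {
  rrank : nat -> nat;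
  rdeg : forall i, 'I_(rrank i) -> int;
  raug : grhom (gfree k n (@rdeg 0)) M;
  rd : forall i, grhom (gfree k n (@rdeg i.+1)) (gfree k n (@rdeg i));
  raug_surj : forall x, exists v, x = raug v;
  raug_exact : forall v, raug v = 0 <-> exists w, v = rd 0 w;
  rd_exact : forall i v, rd i v = 0 <-> exists w, v = rd i.+1 w;
  rd_min : forall i w, irrelevant_entries (rd i w)
}.

(* The number of summands R(-j) of M^i. *)
Definition betti (M : grmod k n) (r : minres M) (i : nat) (j : int) : nat :=
  #|[set l | rdeg (m := r) (i := i) l == j]|.

Definition linearly_presented (M : grmod k n) (r : minres M) (m : int) (o : nat) :
    Prop :=
  forall i, (i <= o)%N -> forall l, rdeg (m := r) (i := i) l = m + i%:Z.

Section Lift.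
Variables (E G : grmod k n) (mu : grhom E G) (rE : minres E) (rG : minres G).

Record reslift := ResLift {
  lmap : forall i, grhom (gfree k n (@rdeg _ rE i)) (gfree k n (@rdeg _ rG i));
  lmap_aug : forall v, raug rG (lmap 0 v) = mu (raug rE v);
  lmap_d : forall i w, rd rG i (lmap i.+1 w) = lmap i (rd rE i w)
}.

Variable L : reslift.

Fact nu2_subproof (x : im_mod (rd rE 1)) : lmap L 1 (val x) \in limg (rd rG 1).
Proof.
have /limgP[w ->] := valP x; apply/limgP.
by exists (lmap L 2 w); rewrite lmap_d.
Qed.

(* im e_2 -> im g_2, since e_2 = rd rE 1 and g_2 = rd rG 1. *)
Definition nu2 (x : im_mod (rd rE 1)) : im_mod (rd rG 1) :=
  Sub (lmap L 1 (val x)) (nu2_subproof x).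

Fact nu2_linear : linear nu2.
Proof. by move=> a x y; apply: val_inj; rewrite /= linearP. Qed.
HB.instance Definition _ := GRing.isLinear.Build R (im_mod (rd rE 1))
  (im_mod (rd rG 1)) _ nu2 nu2_linear.
End Lift.

(* Minimality: ker(M^0 -> M) and ker(M^1 -> M^0) consist of vectors with entries
   in the irrelevant ideal. *)
Record minpres (M : grmod k n) := MinPres {
  prank0 : nat;
  prank1 : nat;
  pdeg0 : 'I_prank0 -> int;
  pdeg1 : 'I_prank1 -> int;
  paug : grhom (gfree k n pdeg0) M;
  pd : grhom (gfree k n pdeg1) (gfree k n pdeg0);
  paug_surj : forall x, exists v, x = paug v;
  paug_exact : forall v, paug v = 0 <-> exists w, v = pd w;
  paug_min : forall v, paug v = 0 -> irrelevant_entries v;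
  pd_min : forall w, pd w = 0 -> irrelevant_entries w
}.

Section LinearPart.
Variables (M : grmod k n) (P : minpres M) (m : int).

Definition pmat : 'M[R]_(prank0 P, prank1 P) :=
  \matrix_(i, j) (pd P (delta_mx j 0) : 'cV_(prank0 P)) i 0.

(* The submatrix of pmat whose rows are the generators of degree m and whose
   columns are the syzygies of degree m + 1. *)
Definition linear_part :
    'M[R]_(#|[set i | pdeg0 (m := P) i == m]|, #|[set j | pdeg1 (m := P) j == m + 1]|) :=
  mxsub enum_val enum_val pmat.
End LinearPart.

(* The corank is an integer, so that it can be a difference of ranks. *)
Definition constant_corank a b (A : 'M[R]_(a, b)) (c : int) : Prop :=
  forall x : 'I_n.+1 -> k, (exists i, x i != 0) ->
    (\rank (map_mx (meval x) A))%:Z = a%:Z - c.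

End Resolutions.

(* Main.v *)
From HB Require Import structures.
Require Import Defs.
From mathcomp Require Import all_boot all_order all_algebra.
From mathcomp Require Import boolp.
From mathcomp Require Import mpoly.
From mathcomp Require Import zify.

Set Implicit Arguments.
Unset Strict Implicit.
Unset Printing Implicit Defensive.

Import Order.TTheory GRing.Theory.
Local Open Scope ring_scope.

(* The maps mu^0 and mu^1 are constant surjective matrices M0 and M1, by degree
   reasons. For any minimal presentation of F, lifting its generators to E^0 and its
   linear syzygies to E^1 gives constant matrices T and U fitting in split exact rows
   0 -> k^N -T-> k^aE -M0-> k^aG -> 0 and 0 -> k^N2 -U-> k^bE -M1-> k^bG -> 0, with
   e1 U = T A; this yields the size of the linear part A, and M1 u = g2 t for
   T v = e1 u shows that all syzygies come from degrees m+1 and m+2.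
   At a point x != 0 a local frame y of the bundle E provides h with h(x) != 0 and
   h = Y C + e1 W, C e1 = 0, C Y = h, whence rk e1(x) = aE - r and, since
   h - W e1 = e2 Z, the complex E^2(x) -> E^1(x) -> E^0(x) is exact at E^1(x);
   similarly for G. As coker nu^2 is Artinian and graded, a power of each variable
   sends im g2 into M1 (im e2), so M1 maps ker e1(x) onto ker g1(x). Therefore
   rk A(x) = rk e1(x) - rk g1(x). *)

(** * Graded modules and minimal covers *)

Section Graded.
Variables (k : fieldType) (n : nat).
Local Notation R := {mpoly k[n.+1]}.

(** Since [f] has degree 0 and the grading of [N] is direct, the component of degree [d] of any
    preimage already maps to [y]. *)
Lemma grhom_lift (M N : grmod k n) (f : grhom M N) d (y : N) :
  gpiece d y -> (exists x, y = f x) -> exists2 x, gpiece d x & y = f x.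
Proof.
move=> yd [x yE]; have [s [c [us hc xE]]] := gpiece_sum x.
(* The degree [d] is added to the list, with component 0 if it was absent, so that directness can be
   read off at [d]. *)
pose t := if d \in s then s else d :: s.
have ut : uniq t by rewrite /t; case: ifP => //= ->.
have dt : d \in t by rewrite /t; case: ifP => //; rewrite inE eqxx.
pose c' e := if e \in s then c e else 0.
have c'P e : gpiece e (c' e) by rewrite /c'; case: ifP => // _; apply: gpiece0.
have xE' : x = \sum_(e <- t) c' e.
  rewrite xE /t; case: ifP => ds; rewrite ?big_cons.
    by apply: eq_big_seq => e es; rewrite /c' es.
  by rewrite /c' ds add0r; apply: eq_big_seq => e es; rewrite es.
exists (c' d) => //.
have := @gpiece_direct _ _ N t (fun e => f (c' e) - (if e == d then y else 0)) ut.
move=> /(_ _ _ d dt) /=; rewrite eqxx => H.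
apply/esym/eqP; rewrite -subr_eq0; apply/eqP; apply: H.
  move=> e; apply: gpieceB; first exact: ghom_deg.
  by case: eqP => [->|_] //; apply: gpiece0.
rewrite sumrB -linear_sum -xE' -yE (bigD1_seq d) //= eqxx big1 ?addr0 ?subrr //.
by move=> e /negbTE ->.
Qed.

Lemma gpiece_bigsum (M : grmod k n) d I (s : seq I) (P : pred I) (F : I -> M) :
  (forall i, P i -> gpiece d (F i)) -> gpiece d (\sum_(i <- s | P i) F i).
Proof. by apply: big_ind => [|x y]; [apply: gpiece0 | apply: gpieceD]. Qed.

Lemma zgpieceZ (M : grmod k n) e d (p : R) (x : M) :
  zhomog e p -> gpiece d x -> gpiece (e + d) (p *: x).
Proof.
case: e => e /= hp hx; first exact: gpieceZ.
by rewrite hp scale0r; apply: gpiece0.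
Qed.

Section FreeMap.
Variables (M : grmod k n) (N : nat) (deg : 'I_N -> int) (g : 'I_N -> M).
Hypothesis hg : forall i, gpiece (deg i) (g i).

Definition span_map (v : gfree k n deg) : M := \sum_i (v : 'cV_N) i 0 *: g i.

Lemma span_map_linear : linear span_map.
Proof.
move=> a u v; rewrite /span_map scaler_sumr -big_split; apply: eq_bigr => i _.
by rewrite !mxE scalerDl scalerA.
Qed.
HB.instance Definition _ := GRing.isLinear.Build R (gfree k n deg) M _ span_map
  span_map_linear.

Lemma span_map_deg d v : gpiece d v -> gpiece d (span_map v).
Proof.
move=> hv; apply: gpiece_bigsum => i _.
by rewrite -[d](subrK (deg i)); apply: zgpieceZ (hv i) (hg i).
Qed.

Definition gspan : grhom (gfree k n deg) M := GrHom span_map_deg.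

Lemma gspanE v : gspan v = \sum_i (v : 'cV_N) i 0 *: g i.
Proof. by []. Qed.
End FreeMap.

Definition ginc (M N : grmod k n) (f : grhom M N) : gker f -> M := val.

Lemma ginc_linear (M N : grmod k n) (f : grhom M N) : linear (@ginc M N f).
Proof. by []. Qed.
HB.instance Definition _ M N f := GRing.isLinear.Build R (@gker k n M N f) M _
  (@ginc M N f) (@ginc_linear M N f).

Definition gker_inc (M N : grmod k n) (f : grhom M N) : grhom (gker f) M :=
  @GrHom k n (gker f) M (@ginc M N f) (fun _ _ h => h).

Definition hcomp (M N P : grmod k n) (g : grhom N P) (f : grhom M N) : grhom M P :=
  @GrHom k n M P (g \o f) (fun d x h => ghom_deg g (ghom_deg f h)).

Section KernelLift.
Variables (A M N : grmod k n) (f : grhom M N) (h : grhom A M).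
Hypothesis fh0 : forall x, f (h x) = 0.

Definition ker_lift (x : A) : gker f := Sub (h x) (introT eqP (fh0 x)).

Lemma ker_lift_linear : linear ker_lift.
Proof. by move=> a x y; apply: val_inj; rewrite /= linearP. Qed.
HB.instance Definition _ := GRing.isLinear.Build R A (gker f) _ ker_lift ker_lift_linear.

Definition gker_lift : grhom A (gker f) :=
  @GrHom k n A (gker f) ker_lift (fun d x hx => ghom_deg h hx).
End KernelLift.

Lemma coef0_zhomog d (p : R) : zhomog d p -> p@_0%MM != 0 -> d = 0.
Proof.
case: d => d /= hp; last by rewrite hp mcoeff0 eqxx.
case: d hp => // d hp; rewrite (dhomog_nemf_coeff hp) ?eqxx //.
by rewrite /= mdeg0.
Qed.

Lemma zhomog0E (p : R) : zhomog 0 p -> p = (p@_0%MM)%:MP.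
Proof.
move=> /= hp; apply/mpolyP => w; rewrite mcoeffC.
have [->|w0] := eqVneq w 0%MM; first by rewrite mulr1.
by rewrite mulr0 (dhomog_nemf_coeff hp) //= mdeg_eq0.
Qed.

Lemma zhomogC (c : k) : zhomog 0 (c%:MP : R).
Proof.
by rewrite /= -[c%:MP]mulr1 mul_mpolyC; apply: dhomogZ; apply: dhomog1.
Qed.

(** The kernel of [f] is graded, so some homogeneous component of [v] keeps a nonzero constant term
    at [i]; such a term can only occur in degree [deg i]. *)
Lemma homog_relation N (deg : 'I_N -> int) M (f : grhom (gfree k n deg) M)
    (v : 'cV[R]_N) i :
  f v = 0 -> (v i 0)@_0%MM != 0 ->
  exists w : 'cV[R]_N, [/\ f w = 0, gpiece (g := gfree k n deg) (deg i) w
    & (w i 0)@_0%MM != 0].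
Proof.
move=> fv0 vi; have vK : v \in Defs.lker f by rewrite inE fv0.
have [s [c [_ hc /(congr1 (gker_inc f))]]] := gpiece_sum (Sub v vK : gker f).
rewrite linear_sum /= => vE; have {}vE : v = \sum_(d <- s) val (c d) by [].
have [e ce] : exists e, ((val (c e) : 'cV[R]_N) i 0)@_0%MM != 0.
  apply: contrapT => nex; move/negP: vi; apply; rewrite vE summxE raddf_sum /=.
  apply/eqP/big1 => e _; apply/eqP/negP => /negP h; apply: nex.
  by exists e.
exists (val (c e)); split=> //; first exact/eqP/(valP (c e)).
suff <- : e = deg i by apply: hc.
by apply/eqP; rewrite -subr_eq0; apply/eqP; apply: coef0_zhomog (hc e i) ce.
Qed.

(** Induction on the number of generators: if the cover is not minimal, a homogeneous relation has a
    unit as coefficient of some generator, which can then be discarded. *)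
Lemma minimal_cover (M : grmod k n) N (g : 'I_N -> M) (dg : 'I_N -> int) :
    (forall i, gpiece (dg i) (g i)) ->
    (forall y : M, exists c : 'I_N -> R, y = \sum_i c i *: g i) ->
  exists N' (deg : 'I_N' -> int) (f : grhom (gfree k n deg) M),
    (forall y, exists v, y = f v) /\
    (forall v, f v = 0 -> irrelevant_entries (v : 'cV_N')).
Proof.
elim: N => [|N IHN] in g dg * => hg gen.
  exists 0%N, dg, (gspan hg); split=> [y|v _ []//].
  by have [c ->] := gen y; exists 0; rewrite gspanE !big_ord0.
have [min|/existsNP[v /not_implyP[fv /existsNP[i /eqP vi]]]] :=
    pselect (forall v, gspan hg v = 0 -> irrelevant_entries (v : 'cV_N.+1)).
  exists N.+1, dg, (gspan hg); split=> // y.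
  have [c ->] := gen y; exists (\col_i c i : 'cV_N.+1); rewrite gspanE.
  by apply: eq_bigr => i _; rewrite mxE.
have [w [fw wd wi]] := homog_relation fv vi.
apply: (IHN (g \o lift i) (dg \o lift i)) => [j|y]; first exact: hg.
have [c ->] := gen y; move/eqP: fw; rewrite gspanE !(bigD1_ord i) //=.
(* Entry [i] of [w] has degree 0, hence is the nonzero constant [u]; dividing by it expresses [g i]
   through the other generators. *)
have := wd i; rewrite subrr => /zhomog0E ->; set u := _@_0%MM in wi *.
rewrite addr_eq0 => /eqP/(congr1 (GRing.scale (u^-1)%:MP)).
rewrite scalerA -mpolyCM mulVf // scale1r => ->.
exists (fun j => - (c i * (u^-1)%:MP * w (lift i j) 0) + c (lift i j)).
rewrite scalerA scalerN scaler_sumr -sumrN -big_split /=.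
by apply: eq_bigr => j _; rewrite scalerDl scaleNr scalerA.
Qed.

(** Lift each [g l] to a homogeneous [w l]. The basis vector [i] minus a combination of the [w l] is
    a relation, without constant terms by minimality; so some [w l] has a unit as entry [i], and the
    degrees agree. *)
Lemma minimal_cover_deg (M : grmod k n) K (g : 'I_K -> M) (dg : 'I_K -> int)
    N (deg : 'I_N -> int) (f : grhom (gfree k n deg) M) :
    (forall l, gpiece (dg l) (g l)) ->
    (forall y : M, exists c : 'I_K -> R, y = \sum_l c l *: g l) ->
    (forall y, exists v, y = f v) ->
    (forall v, f v = 0 -> irrelevant_entries (v : 'cV_N)) ->
  forall i, exists l, deg i = dg l.
Proof.
move=> hg gen surj min i.
have lift l : exists w : 'cV[R]_N, gpiece (g := gfree k n deg) (dg l) w /\ g l = f w.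
  by have [w] := grhom_lift (hg l) (surj _); exists w.
pose w l := projT1 (cid (lift l)).
have hw l := projT2 (cid (lift l)) : gpiece (g := gfree k n deg) _ (w l) /\ g l = f (w l).
have [c fE] := gen (f (delta_mx i 0 : 'cV[R]_N)).
have /min/(_ i) : f (delta_mx i 0 - \sum_l c l *: w l) = 0.
  rewrite linearB linear_sum fE -sumrB big1 // => l _.
  by rewrite linearZ /= (hw l).2 subrr.
rewrite !mxE !eqxx mcoeffB mcoeff1 eqxx summxE raddf_sum /= => /eqP.
have [[l wl] _|nex] := pselect (exists l, (w l i 0)@_0%MM != 0).
  exists l; apply/eqP; rewrite eq_sym -subr_eq0; apply/eqP.
  exact: coef0_zhomog ((hw l).1 i) wl.
rewrite big1 ?subr0 ?oner_eq0 // => l _; rewrite mxE rmorphM /=.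
have [->|wl] := eqVneq (w l i 0)@_0%MM 0; first by rewrite mulr0.
by case: nex; exists l.
Qed.

Definition gmx N N' (deg : 'I_N -> int) (deg' : 'I_N' -> int)
    (f : grhom (gfree k n deg) (gfree k n deg')) : 'M[R]_(N', N) :=
  \matrix_(i, j) (f (delta_mx j 0) : 'cV_N') i 0.

Lemma gmxE N N' (deg : 'I_N -> int) (deg' : 'I_N' -> int)
    (f : grhom (gfree k n deg) (gfree k n deg')) (v : 'cV[R]_N) :
  f v = gmx f *m v :> 'cV_N'.
Proof.
have {1}-> : v = \sum_j v j 0 *: delta_mx j 0.
  rewrite {1}(matrix_sum_delta v); apply: eq_bigr => j _.
  by rewrite big_ord1.
rewrite linear_sum; apply/colP => i; rewrite summxE mxE; apply: eq_bigr => j _.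
by rewrite linearZ !mxE mulrC.
Qed.

(** Reduction modulo the irrelevant ideal; [emb] is its section. *)
Definition cst N N' (v : 'M[R]_(N, N')) : 'M[k]_(N, N') := map_mx (mcoeff 0%MM) v.
Definition emb N N' (v : 'M[k]_(N, N')) : 'M[R]_(N, N') :=
  map_mx (@mpolyC n.+1 k) v.

Lemma cst_irrelevant N (v : 'cV[R]_N) : irrelevant_entries v <-> cst v = 0.
Proof.
split=> [h|/colP h i]; first by apply/colP => i; rewrite !mxE; apply: h.
by have := h i; rewrite !mxE.
Qed.

Lemma embK N N' (v : 'M[k]_(N, N')) : cst (emb v) = v.
Proof. by apply/matrixP => i j; rewrite !mxE mcoeffC eqxx mulr1. Qed.

Lemma cstM N N' N'' (u : 'M[R]_(N, N')) (v : 'M[R]_(N', N'')) :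
  cst (u *m v) = cst u *m cst v.
Proof. exact: map_mxM. Qed.

Lemma embM N N' N'' (u : 'M[k]_(N, N')) (v : 'M[k]_(N', N'')) :
  emb (u *m v) = emb u *m emb v.
Proof. exact: map_mxM. Qed.

Lemma emb1 a : emb (1%:M : 'M[k]_a) = 1%:M.
Proof. exact: map_scalar_mx. Qed.

Lemma embB a b (X Y : 'M[k]_(a, b)) : emb (X - Y) = emb X - emb Y.
Proof. exact: map_mxB. Qed.

End Graded.

(** * Local frames at a closed point *)

Section ClosedPoint.
Variables (k : fieldType) (n : nat) (x : 'I_n.+1 -> k).
Local Notation R := {mpoly k[n.+1]}.

(** The restriction of [p] to the line through the origin and [x], as a polynomial in the parameter
    of that line. *)
Definition line_eval (p : R) : {poly k} := mmap polyC (fun i => x i *: 'X) p.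

Lemma line_eval_homog d (p : R) :
  p \is d.-homog -> line_eval p = p.@[x] *: 'X^d.
Proof.
move=> hp; rewrite /line_eval /meval /mmap scaler_suml !big_seq.
apply: eq_bigr => w /(dhomog_mf hp) /= <-; rewrite -scalerA -mul_polyC; congr (_ * _).
rewrite /mmap1 -mul_polyC rmorph_prod mdegE expr_sum -big_split /=.
by apply: eq_bigr => i _; rewrite exprZn rmorphXn /= -mul_polyC rmorphXn.
Qed.

Lemma coef_line_eval p d : (line_eval p)`_d = (pihomog mdeg d p).@[x].
Proof.
(* The bound is raised to at least [d.+1] so that degree [d] occurs among the listed components. *)
have h := leq_maxl (msize p) d.+1; rewrite {1}(pihomog_partitionE h).
rewrite /line_eval (big_morph _ (mmapD _ _) (mmap0 _ _)) coef_sum.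
have ltd : (d < maxn (msize p) d.+1)%N by rewrite leq_max ltnSn orbT.
rewrite (bigD1 (Ordinal ltd)) //= big1 => [|a].
  by rewrite -/(line_eval _) (line_eval_homog (pihomogP _ _ _)) coefZ coefXn eqxx mulr1 addr0.
rewrite -val_eqE /= => ne; rewrite -/(line_eval _) (line_eval_homog (pihomogP _ _ _)).
by rewrite coefZ coefXn eq_sym (negbTE ne) mulr0.
Qed.

Hypothesis x_neq0 : exists i, x i != 0.

(* The homogeneous ideal of the point x, as the kernel of the restriction to the
   line through x: this makes primality immediate. *)
Definition closed_point : point k n.
Proof.
apply: (@Point _ _ (fun p => line_eval p = 0)); rewrite /line_eval.
- exact: rmorph0.
- by move=> f g f0 g0; rewrite rmorphD /= f0 g0 addr0.
- by move=> f g g0; rewrite rmorphM /= g0 mulr0.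
- by move=> f g /eqP; rewrite rmorphM mulf_eq0 => /orP[]/eqP; [left|right].
- move=> f d f0; rewrite -/(line_eval _) (line_eval_homog (pihomogP _ _ _)).
  by rewrite -coef_line_eval /line_eval f0 coef0 scale0r.
have [i xi] := x_neq0; exists i; rewrite mmapX mmap1U => /eqP.
by rewrite scaler_eq0 (negbTE xi) polyX_eq0.
Defined.

Lemma closed_pointP d (f : R) : f \is d.-homog -> closed_point f <-> f.@[x] = 0.
Proof.
move=> hf; rewrite /= (line_eval_homog hf); split=> [/eqP|->]; last by rewrite scale0r.
by rewrite scaler_eq0 (negbTE (monic_neq0 (monicXn _ _))) orbF => /eqP.
Qed.
End ClosedPoint.

(** * Fractions in the stalks and the sections they define *)

Section Fractions.
Variables (k : fieldType) (n : nat).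
Local Notation R := {mpoly k[n.+1]}.

Lemma is_frac_eq (M : grmod k n) (p : point k n) (s : stalk M p) x y f g :
  is_frac s x f -> is_frac s y g ->
  exists h e, [/\ h \is e.-homog, ~ p h & h *: (g *: x - f *: y) = 0].
Proof. by move=> [a [-> <- <-]] [b [/germ_eq h <- <-]]. Qed.

Lemma is_frac_den (M : grmod k n) (p : point k n) (s : stalk M p) x f :
  is_frac s x f -> exists d, [/\ gpiece d%:Z x, f \is d.-homog & ~ p f].
Proof.
by move=> [a [_ <- <-]]; exists (fdeg a); split; [apply: fnumP|apply: fdenP|apply: fdenN].
Qed.

Lemma is_frac_addl (M : grmod k n) (p : point k n) (s t : stalk M p) x y f :
  is_frac s x f -> is_frac t y f -> is_frac (s + t) (x + y) f.
Proof.
move=> sx ty; have [d [hx hf pf]] := is_frac_den sx.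
have [e [hy hf' _]] := is_frac_den ty.
(* A nonzero denominator has a unique degree, so both numerators lie in the same graded piece and
   can be added. *)
have fN0 : f != 0 by apply/eqP => f0; apply: pf; rewrite f0; apply: pideal0.
have de : d = e by apply: dhomog_uniq hf hf'.
subst e; have [a [-> ax af]] := is_fracD sx ty.
exists (Frac (gpieceD hx hy) hf pf); split=> //.
by apply: germ_eqW; rewrite /= ax af -scalerDr scalerA.
Qed.

Lemma is_frac_sum (M : grmod k n) (p : point k n) I (r : seq I)
    (s : I -> stalk M p) (x : I -> M) f d :
  f \is d.-homog -> ~ p f -> (forall i, is_frac (s i) (x i) f) ->
  is_frac (\sum_(i <- r) s i) (\sum_(i <- r) x i) f.
Proof.
move=> hf pf h; apply: (big_ind2 (fun s x => is_frac s x f)) => //.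
  exists (Frac (gpiece0 M d%:Z) hf pf); split=> //.
  by apply: germ_eqW; rewrite /= !scaler0.
by move=> s1 x1 s2 x2; apply: is_frac_addl.
Qed.

Lemma is_frac_cancel (M : grmod k n) (p : point k n) (s : stalk M p) x f g d :
  is_frac s (g *: x) (f * g) -> f \is d.-homog -> gpiece d%:Z x -> is_frac s x f.
Proof.
move=> [a [-> ax af]] hf hx.
have pf : ~ p f by move=> pf; apply: (@fdenN _ _ _ _ a); rewrite af mulrC; apply: pidealM.
exists (Frac hx hf pf); split=> //; apply: germ_eqW.
by rewrite /= ax af scalerA.
Qed.

Lemma is_frac_zero (M : grmod k n) (p : point k n) (s : stalk M p) f :
  is_frac s 0 f -> s = 0.
Proof.
move=> [a [-> a0 _]]; apply: germ_eqW.
by rewrite /= a0 !scaler0.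
Qed.

Section FracSect.
Variables (M : grmod k n) (U : zopen k n) (d : nat) (x : M) (f : R).
Hypotheses (hx : gpiece d%:Z x) (hf : f \is d.-homog) (hU : forall q, U q -> ~ q f).

Definition frac_at (q : zpt U) : stalk M (sval q) :=
  germ (Frac hx hf (hU (svalP q))).

Lemma frac_at_locally : locally_frac frac_at.
Proof.
move=> q; exists (zfull k n), x, f; split=> // q' _.
by exists (Frac hx hf (hU (svalP q'))).
Qed.

Definition frac_sect : sect M U := Sect frac_at_locally.

Lemma frac_sectP (q : zpt U) : is_frac (frac_sect q) x f.
Proof. by exists (Frac hx hf (hU (svalP q))). Qed.
End FracSect.

Fact basic_open_subproof d (f : R) :
  f \is d.-homog -> zariski_open (fun p : point k n => ~ p f).
Proof.
move=> hf; exists (fun g => g = f); split=> [_ ->|p]; first by exists d.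
by split=> [pf|[_ ->]] //; exists f.
Qed.
Definition basic_open d (f : R) (hf : f \is d.-homog) : zopen k n :=
  ZOpen (basic_open_subproof hf).

Lemma zopen_bigcap (p : point k n) r (U : 'I_r -> zopen k n) :
  (forall i, U i p) -> exists2 V : zopen k n, V p & forall i, zsub V (U i).
Proof.
elim: r => [|r IHr] in U * => Up; first by exists (zfull k n) => // -[].
have [V Vp VU] := IHr (U \o lift ord0) (fun i => Up _).
exists (zinter (U ord0) V) => [|i]; first by split.
by have [j ->|->] := unliftP ord0 i => q [//]; move=> _; apply: (VU j).
Qed.

Lemma sect_sumE (M : grmod k n) (U : zopen k n) I (r : seq I) (s : I -> sect M U) q :
  (\sum_(i <- r) s i) q = \sum_(i <- r) s i q.
Proof. by apply: (big_morph (fun t : sect M U => t q)). Qed.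

Lemma fres_delta r (U V : zopen k n) (VU : zsub V U) (j : 'I_r) :
  fres VU (delta_mx j 0) = delta_mx j 0.
Proof. by apply/colP => i; rewrite !mxE; apply: sect_eq => q; case: (_ && _). Qed.

End Fractions.

(** * Local frames of a vector bundle by elements of the module *)

Section Bundle.
Variables (k : fieldType) (n : nat).
Local Notation R := {mpoly k[n.+1]}.

Lemma dhomogXn (i : 'I_n.+1) d : ('X_i ^+ d : R) \is d.-homog.
Proof. by rewrite mpolyXn dhomogX /= mdegMn mdeg1 mul1n. Qed.

(** A trivialization near [p] gives a basis of sections, which are fractions on a common
    neighbourhood; the [y j] are their numerators. Generation and independence of the sections pass
    to the numerators by clearing denominators. *)
Lemma bundle_frame_at (M : grmod k n) r (p : point k n) :
    vector_bundle r (sheafify M) ->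
  exists (y : 'I_r -> M) (e : 'I_r -> int),
    [/\ forall j, gpiece (e j) (y j),
        forall d (z : M), gpiece d z -> exists (h : R) (b : nat) (c : 'I_r -> R),
          [/\ h \is b.-homog, ~ p h & h *: z = \sum_j c j *: y j] &
        forall c : 'I_r -> R, \sum_j c j *: y j = 0 -> forall j, c j = 0].
Proof.
move=> /(_ p)[W Wp [phi [phi_bij phi_res]]].
(* Powers of a variable outside [p] serve as denominators that bring homogeneous elements to degree
   0. *)
have [l pl] := pideal_relevant p.
have pXn d : ~ p ('X_l ^+ d).
  by elim: d => [|d IHd]; [apply: pidealN1 | rewrite exprS; apply: pidealNM].
have [g phiK gK] := phi_bij _ (@zsub_refl _ _ W).
pose s j : sect M W := g (delta_mx j 0).
have : forall j, exists t : zopen k n * M * R, t.1.1 p /\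
    forall q : zpt W, t.1.1 (sval q) -> is_frac (s j q) t.1.2 t.2.
  move=> j; have [V [x [f [Vp sx]]]] := sfunP (s j) (exist _ p Wp).
  by exists (V, x, f).
move=> /choice[t tP].
have [V' V'p V't] := @zopen_bigcap _ _ p r (fun j => (t j).1.1) (fun j => (tP j).1).
(* On [V] every [s j] is a single fraction and the variable ['X_l] is invertible. *)
pose V := zinter (zinter W V') (basic_open (dhomogXn l 1)).
have VW : zsub V W by move=> q [[]].
have Vp : V p by [].
have sV j (q : zpt V) : is_frac (s j (zincl VW q)) (t j).1.2 (t j).2.
  by apply: (tP j).2; apply: V't; case: q => q [[]].
have VX d q : V q -> ~ q ('X_l ^+ d).
  move=> [_ /= ql]; elim: d => [|d IHd]; first exact: pidealN1.
  by rewrite exprS; apply: pidealNM.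
pose P := exist _ p Vp : zpt V.
have phis j : phi V VW (sres VW (s j)) = delta_mx j 0.
  by rewrite [LHS](phi_res W V (@zsub_refl _ _ W)) gK [LHS]fres_delta.
have phi_sum (a : 'I_r -> OX V) :
    phi V VW (\sum_j a j *: sres VW (s j)) = \col_j a j.
  rewrite linear_sum; apply/colP => i; rewrite summxE mxE (bigD1 i) //=.
  rewrite linearZ /= phis !mxE !eqxx mulr1 big1 ?addr0 // => j ji.
  by rewrite linearZ /= phis !mxE eq_sym (negbTE ji) mulr0.
have tden j : {e : nat | [/\ gpiece e%:Z (t j).1.2, (t j).2 \is e.-homog
    & ~ p (t j).2]}.
  by apply: cid; apply: (is_frac_den (sV j P)).
pose e j : int := (sval (tden j))%:Z.
exists (fun j => (t j).1.2), e; split=> [j|d z zd|c].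
- by case: (svalP (tden j)).
(* A power of ['X_l] first makes the degree of [z] nonnegative, as numerators of fractions have
   natural degrees. *)
- have [N [d' dE]] : exists N d' : nat, N%:Z + d = d'%:Z.
    by case: d {zd} => d; [exists 0%N, d | exists d.+1, 0%N; rewrite NegzE addrN].
  have xzd : gpiece d'%:Z ('X_l ^+ N *: z).
    by rewrite -dE; apply: gpieceZ => //; apply: dhomogXn.
  pose u := frac_sect xzd (dhomogXn l d') (@VX d').
  have uE : u = \sum_j (phi V VW u) j 0 *: sres VW (s j).
    apply: (bij_inj (phi_bij V VW)); rewrite phi_sum.
    by apply/colP => i; rewrite mxE.
  (* Expanding [u] in the frame shows that its germ at [p] is also a fraction whose numerator is a
     combination of the [y j]. *)
  have : exists num den, is_frac (u P) num den /\
      exists c : 'I_r -> R, num = \sum_j c j *: (t j).1.2.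
    rewrite uE sect_sumE.
    apply: (big_ind (fun v => exists num den, is_frac v num den /\
      exists c : 'I_r -> R, num = \sum_j c j *: (t j).1.2)).
    + exists 0, 1; split; first exact: is_frac0.
      by exists (fun=> 0); rewrite big1 // => j _; rewrite scale0r.
    + move=> v1 v2 [n1 [d1 [f1 [c1 E1]]]] [n2 [d2 [f2 [c2 E2]]]].
      exists (d2 *: n1 + d1 *: n2), (d1 * d2); split; first exact: is_fracD.
      exists (fun j => d2 * c1 j + d1 * c2 j); rewrite E1 E2 !scaler_sumr -big_split.
      by apply: eq_bigr => j _; rewrite scalerDl !scalerA.
    move=> j _; have [V1 [a [b [V1p ab]]]] := sfunP (phi V VW u j 0) P.
    exists ((a : R) *: (t j).1.2), (b * (t j).2); split.
      by apply: is_fracZ; [apply: ab | apply: (sV j P)].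
    exists (fun i => if i == j then (a : R) else 0); rewrite (bigD1 j) //= eqxx.
    by rewrite big1 ?addr0 // => i /negbTE ->; rewrite scale0r.
  move=> [num [den [fu [c numE]]]].
  have [d1 [_ hden pden]] := is_frac_den fu.
  have [h [b [hh ph]]] := is_frac_eq (frac_sectP xzd (dhomogXn l d') (@VX d') P) fu.
  move=> /eqP; rewrite scalerBr subr_eq0 !scalerA numE => /eqP E.
  exists (h * den * 'X_l ^+ N), (b + d1 + N)%N, (fun j => h * 'X_l ^+ d' * c j).
  split.
  + by rewrite !dhomogM // dhomogXn.
  + by do 2!apply: pidealNM => //.
  by rewrite -!mulrA E scaler_sumr; apply: eq_bigr => j _; rewrite !scalerA.
have ye j : gpiece (e j) (t j).1.2 by case: (svalP (tden j)).
(* The relations among the [y j] form a graded kernel, so it suffices to kill the homogeneous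
   ones. *)
pose f := gspan ye => c0.
pose v : 'cV[R]_r := \col_j c j.
have vK : v \in Defs.lker f.
  rewrite inE gspanE; apply/eqP; rewrite -[RHS]c0; apply: eq_bigr => j _.
  by rewrite mxE.
suff v0 : v = 0 by move=> j; have /colP/(_ j) := v0; rewrite !mxE.
have [I [w [_ wh /(congr1 (gker_inc f))]]] := gpiece_sum (Sub v vK : gker f).
rewrite linear_sum /= => vE; have {}vE : v = \sum_(d <- I) val (w d) by [].
rewrite vE big1 // => d _; move: (w d) (wh d) => {vE wh}u ud.
have /eqP := valP u; move: (val u : 'cV[R]_r) (ud : free_piece _ d _) => {w u ud v vK}v wd.
rewrite gspanE => v0; apply/colP => j; rewrite mxE.
(* In negative degree the entries vanish at once, because all [e j] are nonnegative. *)
case: d wd => d wd; last first.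
  have -> // : v j 0 = 0; have := wd j; rewrite /e; move: (sval _) => a.
  by rewrite (_ : _ - _ = Negz (d + a)%N) // !NegzE -opprD -PoszD addSn.
have fd i : gpiece (g := gring k n) d%:Z ((t i).2 * v i 0).
  have [_ he _] := svalP (tden i).
  by have := zhomogM he (wd i); rewrite addrC subrK.
pose b i : OX V := frac_sect (fd i) (dhomogXn l d) (@VX d).
(* With [b i] equal to [v i] times the denominator of [s i], over ['X_l ^+ d], the denominators of
   the sections cancel and the sum becomes the given relation over ['X_l ^+ d]. *)
have u0 : \sum_i b i *: sres VW (s i) = 0.
  apply: sect_eq => q; rewrite sect_sumE; apply: (@is_frac_zero _ _ _ _ _ ('X_l ^+ d)).
  rewrite -[X in is_frac _ X _]v0; apply: (is_frac_sum _ (dhomogXn l d)).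
    exact: VX _ _ (svalP q).
  move=> i; apply: (@is_frac_cancel _ _ _ _ _ _ _ (t i).2 d); last 2 first.
  - exact: dhomogXn.
  - rewrite -[d%:Z](subrK (e i)); exact: zgpieceZ (wd i) (ye i).
  by rewrite scalerA; have := is_fracZ (frac_sectP (fd i) (dhomogXn l d) (@VX d) q) (sV i q).
(* Hence every [b i] vanishes; at [p] this says that [v j] times factors outside [p] is zero, and
   the polynomial ring is a domain. *)
have /colP/(_ j) : \col_i b i = 0 by rewrite -phi_sum u0 linear0.
rewrite !mxE => bj0; have bjP := frac_sectP (fd j) (dhomogXn l d) (@VX d) P.
rewrite -/(b j) bj0 in bjP.
have [h [a [_ ph]]] := is_frac_eq bjP (is_frac0 _ _).
rewrite scaler0 subr0 scale1r => /eqP.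
have nz g' : ~ p g' -> g' != 0.
  by move=> pg; apply/eqP => g0; apply: pg; rewrite g0; apply: pideal0.
rewrite mulf_eq0 (negbTE (nz _ ph)) mulf_eq0 /=.
by case: (svalP (tden j)) => _ _ /nz/negbTE -> /= /eqP.
Qed.

Lemma bundle_frame (M : grmod k n) r (x : 'I_n.+1 -> k) N (d : int) (z : 'I_N -> M) :
    vector_bundle r (sheafify M) -> (exists i, x i != 0) ->
    (forall i, gpiece d (z i)) ->
  exists (y : 'I_r -> M) (h : R) (c : 'I_N -> 'I_r -> R),
    [/\ h.@[x] != 0, forall i, h *: z i = \sum_j c i j *: y j &
        forall c : 'I_r -> R, \sum_j c j *: y j = 0 -> forall j, c j = 0].
Proof.
move=> bun x0 zd; have [y [e [_ gen ind]]] := bundle_frame_at (closed_point x0) bun.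
have /choice[h hP] : forall i, exists hc : R * ('I_r -> R),
    hc.1.@[x] != 0 /\ hc.1 *: z i = \sum_j hc.2 j *: y j.
  move=> i; have [h [b [c [hh ph E]]]] := gen _ _ (zd i).
  exists (h, c); split=> //=; apply/eqP => hx; apply: ph.
  exact/(closed_pointP x0 hh).
(* The product of the individual denominators is a common one and still does not vanish at [x]. *)
exists y, (\prod_i (h i).1), (fun i j => (\prod_(i' | i' != i) (h i').1) * (h i).2 j).
split=> // [|i].
  by rewrite rmorph_prod; apply/prodf_neq0 => i _; case: (hP i).
rewrite (bigD1 i) //= mulrC -scalerA (hP i).2 scaler_sumr.
by apply: eq_bigr => j _; rewrite scalerA.
Qed.
End Bundle.

(** * Sheafification of a kernel *)

Section KernelSheaf.
Variables (k : fieldType) (n : nat) (M N : grmod k n) (mu : grhom M N).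
Local Notation R := {mpoly k[n.+1]}.
Local Notation inc := (gker_inc mu).

(** Equality of fractions is the vanishing of an element of the kernel, which can be tested in
    [M]. *)
Lemma stalk_map_inc_inj p : injective (@stalk_map _ _ _ _ inc p).
Proof.
move=> s t; rewrite -[s]germK -[t]germK !germ_map.
move=> /germ_eq[h [e [hh ph /= E]]]; apply/germ_eq; exists h, e; split=> //.
exact: val_inj.
Qed.

Lemma sect_map_inc_inj U : injective (@sect_map _ _ _ _ inc U).
Proof.
move=> s t st; apply: sect_eq => q; apply: stalk_map_inc_inj.
by have /= := congr1 (fun u : sect M U => u q) st.
Qed.

(** The vanishing of [mu x / f] means that some [h] outside [p] kills [mu x]; then [h *: x] lies in
    the kernel and can replace the numerator. *)
Lemma stalk_map_inc_lift p (s : stalk M p) x f :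
  is_frac s x f -> stalk_map mu s = 0 ->
  exists (h : R) (e : nat) (y : gker mu), [/\ h \is e.-homog, ~ p h & val y = h *: x].
Proof.
move=> sx s0; have := is_frac_map mu sx; rewrite s0 => mux.
have [h [e [hh ph]]] := is_frac_eq mux (is_frac0 _ _).
rewrite scale1r scaler0 subr0 -linearZ => /eqP hx.
by exists h, e, (Sub (h *: x) hx).
Qed.

Lemma is_frac_inc p (s : stalk M p) x f (h : R) e (y : gker mu) :
  is_frac s x f -> h \is e.-homog -> ~ p h -> val y = h *: x ->
  exists2 t : stalk (gker mu) p, is_frac t y (h * f) & stalk_map inc t = s.
Proof.
move=> [a [-> ax af]] hh ph yE.
have yd : gpiece (e + fdeg a)%N%:Z y.
  by rewrite PoszD /= /ker_piece yE; apply: gpieceZ => //; rewrite -ax; apply: fnumP.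
have hf : h * fden a \is (e + fdeg a).-homog by rewrite dhomogM // fdenP.
exists (germ (Frac yd hf (pidealNM ph (@fdenN _ _ _ _ a)))).
  by exists (Frac yd hf (pidealNM ph (@fdenN _ _ _ _ a))); rewrite -af.
rewrite germ_map; apply: germ_eqW => /=.
by rewrite -[ginc y]/(val y) yE ax scalerA mulrC.
Qed.

(** Germs lift one by one. Near a point one fraction with numerator in the kernel lifts the germs of
    [s] wherever [h] is invertible, and it agrees with the chosen lifts by injectivity on stalks. *)
Lemma sect_map_inc_im U (s : sect M U) :
  sect_map mu s = 0 -> exists t, sect_map inc t = s.
Proof.
move=> s0; have s0q q : stalk_map mu (s q) = 0.
  by have /= := congr1 (fun u : sect N U => u q) s0.
have : forall q, exists t, stalk_map inc t = s q.
  move=> q; have [W [x [f [Wq sx]]]] := sfunP s q.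
  have [h [e [y [hh ph yE]]]] := stalk_map_inc_lift (sx q Wq) (s0q q).
  by have [t _ tE] := is_frac_inc (sx q Wq) hh ph yE; exists t.
move=> tex; pose t q := sval (cid (tex q)).
have tE q : stalk_map inc (t q) = s q := svalP (cid (tex q)).
have tP : locally_frac t.
  move=> q; have [W [x [f [Wq sx]]]] := sfunP s q.
  have [h [e [y [hh ph yE]]]] := stalk_map_inc_lift (sx q Wq) (s0q q).
  exists (zinter W (basic_open hh)), y, (h * f); split=> // q' [Wq' hq'].
  have [u uf uE] := is_frac_inc (sx q' Wq') hh hq' yE.
  by rewrite (_ : t q' = u) //; apply: stalk_map_inc_inj; rewrite uE tE.
by exists (Sect tP); apply: sect_eq => q; apply: tE.
Qed.

Lemma sect_map_inc_ker U (t : sect (gker mu) U) : sect_map mu (sect_map inc t) = 0.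
Proof.
apply: sect_eq => q /=; rewrite -[t q]germK !germ_map.
set x := repr (t q); apply: germ_eqW => /=.
by rewrite scaler0 (eqP (valP (fnum x))) scaler0.
Qed.

Definition to_ker U (t : sheafify (gker mu) U) : oker (sheafify_mor mu) U :=
  Sub (sect_map inc t) (introT eqP (sect_map_inc_ker t)).

Lemma to_ker_linear U : linear (@to_ker U).
Proof. by move=> a s t; apply: val_inj; rewrite /= linearP. Qed.
HB.instance Definition _ U := GRing.isLinear.Build (OX U)
  (sheafify (gker mu) U) (oker (sheafify_mor mu) U) _ (@to_ker U) (@to_ker_linear U).

Lemma to_ker_bij U : bijective (@to_ker U).
Proof.
have ex (s : oker (sheafify_mor mu) U) : exists t, to_ker t = s.
  have [t tE] := sect_map_inc_im (eqP (valP s)).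
  by exists t; apply: val_inj.
exists (fun s => sval (cid (ex s))) => [t|s]; last exact: svalP (cid (ex s)).
by apply: sect_map_inc_inj; exact: (congr1 val (svalP (cid (ex (to_ker t))))).
Qed.

Lemma sheafify_gker : isomorphic (sheafify (gker mu)) (oker (sheafify_mor mu)).
Proof.
exists (fun V _ => @to_ker V : {linear _ -> _}); split=> [V _|U V _ _ VU s].
  exact: to_ker_bij.
by apply: val_inj; apply: sect_eq.
Qed.
End KernelSheaf.

(** * Linear algebra of the fibres *)

Lemma col_factor (S : pzRingType) a b c (X : 'M[S]_(a, b)) (Y : 'M[S]_(a, c)) :
  (forall j, exists w : 'cV_c, Y *m w = col j X) -> exists W, Y *m W = X.
Proof.
move=> /choice[w wP]; exists (\matrix_(i, j) w j i 0).
apply/matrixP => i j; have /colP/(_ i) := wP j; rewrite !mxE => <-.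
by apply: eq_bigr => l _; rewrite mxE.
Qed.

Lemma col_mul (S : pzRingType) a b c (X : 'M[S]_(a, b)) (Y : 'M[S]_(b, c)) j :
  col j (X *m Y) = X *m col j Y.
Proof. by rewrite !colE mulmxA. Qed.

Lemma col_eq (S : Type) a b (X Y : 'M[S]_(a, b)) : (forall j, col j X = col j Y) -> X = Y.
Proof. by move=> h; apply/matrixP => i j; have /colP/(_ i) := h j; rewrite !mxE. Qed.

Lemma mul_cV_eq (S : pzRingType) a b (X Y : 'M[S]_(a, b)) :
  (forall v : 'cV_b, X *m v = Y *m v) -> X = Y.
Proof.
move=> XY; apply/matrixP => i j; have /colP/(_ i) := XY (delta_mx j 0).
by rewrite -!colE !mxE.
Qed.

Section LinearAlgebra.
Variable k : fieldType.

(** [Q] is a section of [A]; since [1%:M - Q *m A] projects onto the kernel of [A], it factors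
    through [T], which yields the retraction [L]. *)
Lemma split_exact p q N (A : 'M[k]_(p, q)) (T : 'M[k]_(q, N)) :
    (forall u : 'cV_p, exists v, A *m v = u) ->
    (forall c : 'cV_N, T *m c = 0 -> c = 0) -> A *m T = 0 ->
    (forall u : 'cV_q, A *m u = 0 -> exists c, T *m c = u) ->
  exists Q L, [/\ A *m Q = 1%:M, L *m T = 1%:M, T *m L = 1%:M - Q *m A &
    (N + p = q)%N].
Proof.
move=> surj inj AT0 ex; have [Q AQ] : exists Q, A *m Q = 1%:M.
  by apply: col_factor => j; apply: surj.
have [L TL] : exists L, T *m L = 1%:M - Q *m A.
  apply: col_factor => j; apply: ex.
  by rewrite -col_mul mulmxBr mulmxA AQ mul1mx mulmx1 subrr; apply/colP => i; rewrite !mxE.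
have LT : L *m T = 1%:M.
  apply: mul_cV_eq => v; apply/eqP; rewrite mul1mx -subr_eq0; apply/eqP/inj.
  rewrite mulmxBr !mulmxA TL mulmxBl mul1mx -[Q *m A *m T]mulmxA AT0 mulmx0 subr0.
  by rewrite subrr.
(* One inequality comes from [A *m T = 0] with [A] and [T] of full rank, the other from writing the
   identity as [T *m L + Q *m A]. *)
exists Q, L; split=> //; apply/eqP; rewrite eqn_leq; apply/andP; split.
  apply: leq_trans (mulmx0_rank_max AT0); rewrite addnC leq_add //.
    by rewrite -{1}(mxrank1 k p) -AQ mxrankM_maxl.
  by rewrite -{1}(mxrank1 k N) -LT mxrankM_maxr.
rewrite -{1}(mxrank1 k q) (_ : 1%:M = T *m L + Q *m A); last by rewrite TL subrK.
apply: leq_trans (mxrank_add _ _) _.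
by rewrite leq_add // mulmx_max_rank.
Qed.

(* Rank form of the exactness of 0 -> im (e psi) -> im e -> im g -> 0. *)
Lemma rank_snake aE bE aG bG c (e : 'M[k]_(aE, bE)) (g : 'M[k]_(aG, bG))
    (A0 : 'M[k]_(aG, aE)) (A1 : 'M[k]_(bG, bE)) (psi : 'M[k]_(bE, c)) :
    A0 *m e = g *m A1 -> (exists Q, A1 *m Q = 1%:M) -> A1 *m psi = 0 ->
    (forall u : 'cV_bE, A1 *m u = 0 -> exists c, psi *m c = u) ->
    (forall v : 'cV_bG, g *m v = 0 -> exists u, e *m u = 0 /\ A1 *m u = v) ->
  (\rank g + \rank (e *m psi) = \rank e)%N.
Proof.
move=> comm [Q AQ] Apsi0 ex lift.
have -> : \rank g = \rank (e^T *m A0^T).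
  rewrite -trmx_mul mxrank_tr comm; apply/eqP; rewrite eqn_leq mxrankM_maxl andbT.
  by rewrite -{1}[g]mulmx1 -AQ mulmxA mxrankM_maxl.
(* Matrices are transposed because subspaces are row spaces. It remains to identify the part of im
   [e] killed by [A0] with the image of [e *m psi]. *)
rewrite -[in RHS]mxrank_tr -(mxrank_mul_ker e^T A0^T); congr (_ + _)%N; rewrite -mxrank_tr.
apply/eqP; rewrite eqn_leq; apply/andP; split; apply: mxrankS.
  rewrite sub_capmx trmx_mul submxMl /=; apply/sub_kermxP.
  by rewrite -mulmxA -!trmx_mul comm -mulmxA Apsi0 mulmx0 trmx0.
apply/rV_subP => v; rewrite sub_capmx => /andP[/submxP[u ->]] /sub_kermxP.
rewrite -mulmxA -trmx_mul => /(congr1 trmx); rewrite -{1}[u]trmxK -trmx_mul trmxK trmx0 comm.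
(* [A1] sends the transpose of [u] into ker [g]; subtracting a lift [u'] taken in ker [e] leaves an
   element of ker [A1], which is the image of [psi]. *)
rewrite -mulmxA => /lift[u' [eu' Au']].
have [w wE] : exists c, psi *m c = u^T - u'.
  by apply: ex; rewrite mulmxBr Au' subrr.
apply/submxP; exists w^T; rewrite -trmx_mul -mulmxA wE mulmxBr eu' subr0.
by rewrite trmx_mul trmxK.
Qed.

End LinearAlgebra.

(** * Powers of a ring element on an Artinian module *)

Section ArtinianPowers.
Variables (S : comPzRingType) (M : lmodType S) (a : S).

Definition power_multiples (i : nat) : {pred M} := [pred x | `[< exists y : M, x = a ^+ i *: y >]].

Fact power_multiplesP i x : reflect (exists y, x = a ^+ i *: y) (x \in power_multiples i).
Proof. by rewrite inE; apply: asboolP. Qed.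

Fact power_multiples_submod i : submod_closed (power_multiples i).
Proof.
split=> [|b _ _ /power_multiplesP[x ->] /power_multiplesP[y ->]]; apply/power_multiplesP.
  by exists 0; rewrite scaler0.
by exists (b *: x + y); rewrite scalerDr !scalerA mulrC.
Qed.
HB.instance Definition _ i :=
  GRing.isSubmodClosed.Build S M (power_multiples i) (power_multiples_submod i).

(** The descending chain of the submodules of multiples of [a ^+ i] becomes stationary. *)
Lemma artinian_power : artinian M ->
  exists N, forall x : M, exists y, a ^+ N *: x = a ^+ N.+1 *: y.
Proof.
move=> /(_ (fun i => power_multiples i : submodClosed M))[i x|N /(_ N.+1 (leqnSn _))].
  move=> /power_multiplesP[y ->]; apply/power_multiplesP.
  by exists (a *: y); rewrite scalerA exprSr.
move=> stab; exists N => x; apply/power_multiplesP.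
by have := stab (a ^+ N *: x) => ->; apply/power_multiplesP; exists x.
Qed.
End ArtinianPowers.

(** * Evaluation of a resolution at a point *)

Section FramePresentation.
Variables (k : fieldType) (n : nat).
Local Notation R := {mpoly k[n.+1]}.

Definition evmx (x : 'I_n.+1 -> k) a b (A : 'M[R]_(a, b)) := map_mx (meval x) A.

Lemma evmxM x a b c (A : 'M[R]_(a, b)) (B : 'M[R]_(b, c)) :
  evmx x (A *m B) = evmx x A *m evmx x B.
Proof. exact: map_mxM. Qed.

Lemma evmx_emb x a b (A : 'M[k]_(a, b)) : evmx x (emb n A) = A.
Proof. by apply/matrixP => i j; rewrite !mxE mevalC. Qed.

Lemma evmx_scalar x a (h : R) : evmx x (h%:M : 'M_a) = (h.@[x])%:M.
Proof. exact: map_scalar_mx. Qed.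

Lemma raug_ker (M : grmod k n) (rs : minres M) v :
  raug rs v = 0 <-> exists w : 'cV_(rrank rs 1), gmx (rd rs 0) *m w = v.
Proof.
split=> [/raug_exact[w ->]|[w <-]]; first by exists w; rewrite -(gmxE (rd rs 0)).
by apply/raug_exact; exists w; rewrite -(gmxE (rd rs 0)).
Qed.

Lemma rd_ker (M : grmod k n) (rs : minres M) i (v : 'cV_(rrank rs i.+1)) :
  gmx (rd rs i) *m v = 0 <-> exists w : 'cV_(rrank rs i.+2), gmx (rd rs i.+1) *m w = v.
Proof.
rewrite -(gmxE (rd rs i)); split=> [/rd_exact[w ->]|[w <-]].
  by exists w; rewrite -(gmxE (rd rs i.+1)).
by apply/rd_exact; exists w; rewrite -(gmxE (rd rs i.+1)).
Qed.

Lemma rd_cst (M : grmod k n) (rs : minres M) i (w : 'cV_(rrank rs i.+1)) : cst (gmx (rd rs i) *m w) = 0.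
Proof. by rewrite -(gmxE (rd rs i)); apply/cst_irrelevant/rd_min. Qed.

Lemma mulmx_sum_col a b (A : 'M[R]_(a, b)) (v : 'cV_b) :
  A *m v = \sum_j v j 0 *: col j A.
Proof.
by apply/colP => i; rewrite summxE mxE; apply: eq_bigr => j _; rewrite !mxE mulrC.
Qed.

Lemma linear_col_sum (M : lmodType R) b (f : {linear 'cV[R]_b -> M}) (v : 'cV_b) :
  f v = \sum_j v j 0 *: f (delta_mx j 0).
Proof.
rewrite -{1}[v]mul1mx mulmx_sum_col linear_sum; apply: eq_bigr => j _.
by rewrite linearZ col1.
Qed.

(** After inverting [h], the frame splits off the image of [e1]: [Y] and [C] include and project the
    free part, while [W] and [Z] are contracting homotopies. Everything survives evaluation because
    [h] does not vanish at [x]. *)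
Lemma frame_presentation (M : grmod k n) (rs : minres M) (d : int) r
    (x : 'I_n.+1 -> k) :
    (forall l, rdeg (m := rs) (i := 0) l = d) ->
    vector_bundle r (sheafify M) -> (exists i, x i != 0) ->
  let e1 := evmx x (gmx (rd rs 0)) in let e2 := evmx x (gmx (rd rs 1)) in
  (\rank e1 + r = rrank rs 0)%N /\
  (forall v : 'cV_(rrank rs 1), e1 *m v = 0 -> exists w, e2 *m w = v).
Proof.
move=> degs bun x0.
have zd (i : 'I_(rrank rs 0)) : gpiece d (raug rs (delta_mx i 0 : 'cV[R]_(rrank rs 0))).
  rewrite -(degs i); apply: ghom_deg => j; rewrite !degs subrr mxE.
  by case: (_ && _); [apply: dhomog1 | apply: dhomog0].
have [y [h [c [hx gen ind]]]] := bundle_frame bun x0 zd.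
have /choice[Y' Y'P] : forall j, exists v : 'cV[R]_(rrank rs 0), y j = raug rs v.
  by move=> j; have [v] := raug_surj rs (y j); exists v.
pose Y : 'M[R]_(rrank rs 0, r) := \matrix_(i, j) Y' j i 0.
pose C : 'M[R]_(r, rrank rs 0) := \matrix_(j, i) c i j.
set e1 := gmx (rd rs 0); set e2 := gmx (rd rs 1).
have raugY (v : 'cV_r) : raug rs (Y *m v) = \sum_j v j 0 *: y j.
  rewrite mulmx_sum_col linear_sum; apply: eq_bigr => j _; rewrite linearZ Y'P /=.
  by congr (_ *: raug rs _); apply/colP => i; rewrite !mxE.
have ker := @raug_ker _ rs.
(* Independence of the frame in [M]: the columns of [Y] are independent modulo the image of [e1].
   The identities for [C *m e1] and [C *m Y] both follow from this. *)
have indY b (V : 'M_(r, b)) (U : 'M_(rrank rs 1, b)) : Y *m V = e1 *m U -> V = 0.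
  move=> VU; apply/matrixP => i j; rewrite [RHS]mxE.
  have /ind/(_ i) : \sum_l (col j V) l 0 *: y l = 0; last by rewrite mxE.
  by rewrite -raugY; apply/ker; exists (col j U); rewrite -!col_mul VU.
have [W WE] : exists W, e1 *m W = h%:M - Y *m C.
  apply: col_factor => i; apply/ker.
  have -> : col i (h%:M - Y *m C) = h *: delta_mx i 0 - Y *m col i C.
    by apply/colP => i'; rewrite -col_mul !mxE andbT mulrC mulr_natl eq_sym.
  rewrite linearB linearZ /= raugY gen; apply/eqP; rewrite subr_eq0; apply/eqP.
  by apply: eq_bigr => j _; rewrite !mxE.
have hE : h%:M = Y *m C + e1 *m W by rewrite WE addrC subrK.
have Ce1 : C *m e1 = 0.
  apply: (indY _ _ (h%:M - W *m e1)).
  rewrite mulmxA mulmxBr mulmxA WE mulmxBl opprB addrCA -scalar_mxC subrr addr0 //.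
have CY : C *m Y = h%:M.
  apply/esym/eqP; rewrite -subr_eq0; apply/eqP/(indY _ _ (W *m Y)).
  by rewrite mulmxA WE mulmxBl mulmxBr scalar_mxC mulmxA.
have [Z ZE] : exists Z, e2 *m Z = h%:M - W *m e1.
  apply: col_factor => j; apply/rd_ker; rewrite -/e1 -col_mul mulmxBr mulmxA WE.
  rewrite mulmxBl -mulmxA Ce1 mulmx0 subr0 -scalar_mxC subrr.
  by apply/colP => i; rewrite !mxE.
split=> [|v ev].
  (* Upper bound: [C] kills [e1] and has rank [r] at [x], since [C *m Y] is the nonzero scalar [h]
     there. Lower bound: ranks in [hE]. *)
  apply/eqP; rewrite eqn_leq; apply/andP; split.
    have := congr1 (fun A => evmx x A) Ce1; rewrite evmxM [X in _ = X]map_mx0 => /mulmx0_rank_max.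
    apply: leq_trans; rewrite addnC leq_add2r.
    have := mxrankM_maxl (evmx x C) (evmx x Y).
    by rewrite -evmxM CY evmx_scalar -scalemx1 mxrank_scale_nz // mxrank1.
  have := congr1 (fun A => \rank (evmx x A)) hE => /=.
  rewrite evmx_scalar -scalemx1 mxrank_scale_nz // mxrank1 => a_eq.
  apply: leq_trans (eq_leq a_eq) _; rewrite /evmx map_mxD !map_mxM; apply: leq_trans (mxrank_add _ _) _.
  by rewrite addnC leq_add ?mulmx_max_rank ?mxrankM_maxl.
(* For [v] killed by [e1] at [x], the identity [ZE] reads [e2 *m (Z *m v) = h *: v] there. *)
exists (h.@[x]^-1 *: (evmx x Z *m v)).
rewrite -scalemxAr mulmxA -evmxM ZE /evmx map_mxB mulmxBl map_mxM -mulmxA ev.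
by rewrite mulmx0 subr0 [map_mx _ _]evmx_scalar mul_scalar_mx scalerA mulVf // scale1r.
Qed.
End FramePresentation.

(** * Matrices with homogeneous entries *)

Section HomogeneousMatrices.
Variables (k : fieldType) (n : nat).
Local Notation R := {mpoly k[n.+1]}.

Lemma zhomog_mulz d e (p q : R) : zhomog d p -> zhomog e q -> zhomog (d + e) (p * q).
Proof.
case: d => d hp hq; first exact: zhomogM.
by rewrite [p]hp mul0r; apply: zhomog0.
Qed.

Lemma zhomog_bigsum d I (s : seq I) (P : pred I) (F : I -> R) :
  (forall i, P i -> zhomog d (F i)) -> zhomog d (\sum_(i <- s | P i) F i).
Proof. exact: (@gpiece_bigsum _ _ (gring k n)). Qed.

Lemma zpihomog_bigsum d I (s : seq I) (P : pred I) (F : I -> R) :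
  zpihomog d (\sum_(i <- s | P i) F i) = \sum_(i <- s | P i) zpihomog d (F i).
Proof.
apply: (big_morph _ (zpihomogD d)).
by case: d => // d; apply: pihomog0.
Qed.

Lemma zpihomog_mul d e (p q : R) :
  zhomog e p -> zpihomog d (p * q) = p * zpihomog (d - e) q.
Proof.
move=> hp; pose s := [seq Posz a | a <- iota 0 (msize q)].
have us : uniq s by rewrite map_inj_uniq ?iota_uniq // => a b [].
have qE : q = \sum_(a <- s) zpihomog a q.
  rewrite -[LHS](@zpihomog_sum _ _ s (msize q) 0) //; last first.
    by move=> a lta; rewrite add0r map_f // mem_iota.
  by apply: eq_bigr => a _; rewrite subr0.
rewrite [in LHS]qE [in RHS]qE mulr_sumr !zpihomog_bigsum mulr_sumr; apply: eq_bigr => a _.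
rewrite (zpihomog_id _ (zhomog_mulz hp (zpihomogP a q))).
rewrite (zpihomog_id _ (zpihomogP a q)) subr_eq [e + a]addrC.
by case: ifP => //; rewrite mulr0.
Qed.

Definition mhomog d a b (A : 'M[R]_(a, b)) := forall i j, zhomog d (A i j).

Lemma mhomogM d e a b c (A : 'M[R]_(a, b)) (B : 'M[R]_(b, c)) :
  mhomog d A -> mhomog e B -> mhomog (d + e) (A *m B).
Proof.
by move=> hA hB i j; rewrite mxE; apply: zhomog_bigsum => l _; apply: zhomog_mulz.
Qed.

Lemma mhomog_emb a b (A : 'M[k]_(a, b)) : mhomog 0 (emb n A).
Proof. by move=> i j; rewrite mxE; apply: zhomogC. Qed.

Lemma mhomog0E a b (A : 'M[R]_(a, b)) : mhomog 0 A -> A = emb n (cst A).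
Proof. by move=> hA; apply/matrixP => i j; rewrite !mxE; apply: zhomog0E. Qed.

Lemma gmx_homog N N' (deg : 'I_N -> int) (deg' : 'I_N' -> int)
    (f : grhom (gfree k n deg) (gfree k n deg')) i j :
  zhomog (deg j - deg' i) (gmx f i j).
Proof.
rewrite mxE; apply: (ghom_deg f (d := deg j)) => l; rewrite mxE.
case: eqP => [->|_] /=; last exact: zhomog0.
by rewrite subrr; apply: dhomog1.
Qed.

Lemma gmx_mhomog N N' (deg : 'I_N -> int) (deg' : 'I_N' -> int) d d'
    (f : grhom (gfree k n deg) (gfree k n deg')) :
  (forall j, deg j = d) -> (forall i, deg' i = d') -> mhomog (d - d') (gmx f).
Proof. by move=> dd dd' i j; have := gmx_homog f i j; rewrite dd dd'. Qed.

Lemma gmx_comp N1 N2 N3 (d1 : 'I_N1 -> int) (d2 : 'I_N2 -> int) (d3 : 'I_N3 -> int)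
    (f : grhom (gfree k n d1) (gfree k n d2)) (g : grhom (gfree k n d2) (gfree k n d3)) :
  gmx (hcomp g f) = gmx g *m gmx f.
Proof.
apply/matrixP => i j; rewrite [LHS]mxE.
transitivity ((gmx g *m (gmx f *m (delta_mx j 0 : 'cV_N1))) i 0).
  exact: (congr1 (fun v : 'cV[R]_N3 => v i 0)
    (etrans (gmxE g _) (congr1 (mulmx (gmx g)) (gmxE f _)))).
by rewrite mulmxA -colE mxE.
Qed.

End HomogeneousMatrices.

(** * Consequences of the Artinian cokernel *)

Section ArtinianCokernel.
Variables (k : fieldType) (n : nat) (E G : grmod k n) (mu : grhom E G).
Variables (resE : minres E) (resG : minres G) (L : reslift mu resE resG) (m : int).
Hypothesis G_deg1 : forall l, rdeg (m := resG) (i := 1) l = m + 1.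
Hypothesis G_deg2 : forall l, rdeg (m := resG) (i := 2) l = m + 2.
Hypothesis art : artinian (coker (nu2 L)).
Local Notation R := {mpoly k[n.+1]}.
Local Notation e1 := (gmx (rd resE 0)).
Local Notation e2 := (gmx (rd resE 1)).
Local Notation g1 := (gmx (rd resG 0)).
Local Notation g2 := (gmx (rd resG 1)).
Local Notation m1 := (gmx (lmap L 1)).

(** Stationarity of the powers of ['X_l] on the cokernel, applied to the class of each column of
    [g2] and written out with representatives. *)
Lemma nu2_power_raw l : exists N, forall j, exists z u,
  'X_l ^+ N *: col j g2 - 'X_l ^+ N.+1 *: (g2 *m z) = m1 *m (e2 *m u).
Proof.
have [N NP] := artinian_power 'X_l art; exists N => j.
pose y0 : 'cV[R]_(rrank resG 1) := col j g2.
have y0P : y0 \in Defs.limg (rd resG 1).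
  by apply/limgP; exists (delta_mx j 0 : 'cV_(rrank resG 2)); rewrite gmxE -colE.
have [z] := NP (coker_proj (nu2 L) (Sub y0 y0P)).
rewrite -(coker_projK z); move: (repr _) => z0.
rewrite -[_ *: coker_proj _ _]/(coker_scale _ _) coker_projZ.
rewrite -[_ *: coker_proj _ _]/(coker_scale _ _) coker_projZ.
move=> /coker_proj_eq/limgP[t tE].
have eqn : 'X_l ^+ N *: y0 - 'X_l ^+ N.+1 *: (val z0 : 'cV_(rrank resG 1))
    = lmap L 1 (val t) := congr1 val tE.
have /limgP[z1 z1E] := valP z0; have /limgP[u uE] := valP t.
have {z1E}z1E := etrans z1E (gmxE (rd resG 1) z1).
have {}uE := etrans uE (gmxE (rd resE 1) u).
have {uE}uE := etrans (gmxE (lmap L 1) (val t)) (congr1 (mulmx m1) uE).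
have {z1E uE}eqn := etrans (etrans (congr1 (fun z => _ - _ *: z) (esym z1E)) eqn) uE.
exists z1, u; exact: eqn.
Qed.
(** The columns of [g2] are linear, so in the previous identity the component of degree [N.+1]
    retains ['X_l ^+ N] times the column and loses the multiple of ['X_l ^+ N.+1]. *)
Lemma nu2_power l : exists N, forall j, exists u,
  m1 *m (e2 *m u) = 'X_l ^+ N *: col j g2.
Proof.
have [N NP] := nu2_power_raw l; exists N => j; have [z [u /eqP]] := NP j.
rewrite subr_eq => /eqP eqn; pose f := hcomp (lmap L 1) (rd resE 1).
(* The component of [u i] that contributes to degree [N.+1]; it depends on [i] because [E] is
   linearly presented only up to order 1. *)
pose d i : int := N.+1%:Z - (rdeg (m := resE) (i := 2) i - (m + 1)).
exists (\col_i zpihomog (d i) (u i 0)); apply/colP => i.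
have X_hom c a b : zhomog c.+1%:Z ('X_l ^+ c * gmx (rd resG 1) a b : R).
  have := zhomogM (dhomogXn k l c) (gmx_homog (rd resG 1) a b).
  by rewrite G_deg1 G_deg2 (_ : _ + _ = c.+1%:Z) //; lia.
have hc c : zhomog (rdeg (m := resE) (i := 2) c - (m + 1)) ((m1 *m e2) i c).
  by rewrite -gmx_comp -(G_deg1 i); apply: gmx_homog.
rewrite mulmxA [RHS]mxE [col _ _ _ _]mxE [LHS]mxE.
move/colP/(_ i)/(congr1 (zpihomog N.+1%:Z)): eqn.
rewrite mulmxA [(_ + _ : 'cV_ _) i 0]mxE [('X_l ^+ N *: _ : 'cV_ _) i 0]mxE [col _ _ _ _]mxE.
rewrite [('X_l ^+ N.+1 *: _ : 'cV_ _) i 0]mxE [(g2 *m z) i 0]mxE [(m1 *m e2 *m u) i 0]mxE.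
rewrite zpihomogD.
rewrite (zpihomog_id _ (X_hom N i j)) eqxx => ->.
(* The coefficients of this sum have degree [N.+2], so only the zero component of degree -1 of [z]
   would contribute. *)
rewrite mulr_sumr !zpihomog_bigsum [X in _ = _ + X]big1 ?addr0; last first.
  move=> a _; rewrite mulrA (zpihomog_mul _ _ (X_hom N.+1 i a)).
  by rewrite (_ : _ - _ = Negz 0) ?mulr0 //; lia.
apply: eq_bigr => c _; by rewrite (zpihomog_mul _ _ (hc c)) [(\col_ _ _) _ _]mxE.
Qed.

(** At a point with nonzero coordinate [x l] the power of ['X_l] can be divided out, so [g2] factors
    through [m1 *m e2]; and the image of [e2] is killed by [e1]. *)
Lemma ker_lift_at (x : 'I_n.+1 -> k) (v : 'cV[k]_(rrank resG 1)) :
    (exists i, x i != 0) -> (exists w, evmx x g2 *m w = v) ->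
  exists u, evmx x e1 *m u = 0 /\ evmx x m1 *m u = v.
Proof.
move=> [l xl] [w <-]; have [N NP] := nu2_power l.
have [U UE] : exists U, evmx x (m1 *m e2) *m U = evmx x g2.
  apply: col_factor => j; have [u uE] := NP j.
  exists ((x l ^+ N)^-1 *: evmx x u); rewrite -scalemxAr -evmxM -mulmxA uE.
  rewrite /evmx map_mxZ /= rmorphXn /= mevalXU scalerA mulVf ?expf_neq0 // scale1r.
  by rewrite map_col.
have e12 : e1 *m e2 = 0.
  apply: mul_cV_eq => u; rewrite mul0mx -mulmxA.
  have /rd_exact : exists u', rd resE 1 u = rd resE 1 u' by exists u.
  by move=> <-; rewrite (gmxE (rd resE 0)) (gmxE (rd resE 1)).
exists (evmx x e2 *m (U *m w)); split.
  by rewrite mulmxA -evmxM e12 /evmx map_mx0 mul0mx.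
by rewrite !mulmxA -evmxM UE.
Qed.
End ArtinianCokernel.

(** * Presentations of the kernel *)

Section KernelPresentation.
Variables (k : fieldType) (n : nat) (E G : grmod k n) (m : int).
Variables (resE : minres E) (resG : minres G).
Hypothesis E_lin : linearly_presented resE m 1.
Hypothesis G_lin : linearly_presented resG m 2.
Variables (mu : grhom E G) (mu_surj : forall y : G, exists x : E, y = mu x).
Variable L : reslift mu resE resG.
Hypothesis mu1_surj : forall w, exists v, w = lmap L 1 v.
Local Notation R := {mpoly k[n.+1]}.
Local Notation aE := (rrank resE 0).
Local Notation aG := (rrank resG 0).
Local Notation bE := (rrank resE 1).
Local Notation bG := (rrank resG 1).
Local Notation e1 := (gmx (rd resE 0)).
Local Notation e2 := (gmx (rd resE 1)).
Local Notation g1 := (gmx (rd resG 0)).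
Local Notation g2 := (gmx (rd resG 1)).
Local Notation m0 := (gmx (lmap L 0)).
Local Notation m1 := (gmx (lmap L 1)).
Local Notation M0 := (cst m0).
Local Notation M1 := (cst m1).
Local Notation F := (gker mu).

Lemma E_deg0 l : rdeg (m := resE) (i := 0) l = m.
Proof. by rewrite (E_lin (i := 0)) ?addr0. Qed.
Lemma E_deg1 l : rdeg (m := resE) (i := 1) l = m + 1.
Proof. exact: (E_lin (i := 1)). Qed.
Lemma G_deg0 l : rdeg (m := resG) (i := 0) l = m.
Proof. by rewrite (G_lin (i := 0)) ?addr0. Qed.
Lemma G_deg1 l : rdeg (m := resG) (i := 1) l = m + 1.
Proof. exact: (G_lin (i := 1)). Qed.
Lemma G_deg2 l : rdeg (m := resG) (i := 2) l = m + 2.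
Proof. exact: (G_lin (i := 2)). Qed.

Lemma m0E : m0 = emb n M0.
Proof. by apply: mhomog0E; have := gmx_mhomog (lmap L 0) E_deg0 G_deg0; rewrite subrr. Qed.

Lemma m1E : m1 = emb n M1.
Proof. by apply: mhomog0E; have := gmx_mhomog (lmap L 1) E_deg1 G_deg1; rewrite subrr. Qed.

Lemma lift_comm : g1 *m m1 = m0 *m e1.
Proof.
apply: mul_cV_eq => v; rewrite -!mulmxA -(gmxE (lmap L 1)) -(gmxE (rd resE 0)).
by rewrite -(gmxE (rd resG 0)) -(gmxE (lmap L 0)) lmap_d.
Qed.

Lemma mu_raug (v : 'cV[R]_aE) : mu (raug resE v) = raug resG (m0 *m v).
Proof. by rewrite -(gmxE (lmap L 0)) lmap_aug. Qed.

(** By surjectivity of [mu], [m0] hits [u] modulo the image of [g1], which has no constant terms. *)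
Lemma M0_surj (u : 'cV[k]_aG) : exists v, M0 *m v = u.
Proof.
have [z zE] := mu_surj (raug resG (emb n u : 'cV_aG)).
have [v vE] := raug_surj resE z; exists (cst (v : 'cV_aE)).
have /raug_ker[w] : raug resG (m0 *m v - emb n u) = 0.
  by rewrite linearB -mu_raug -vE -zE /= subrr.
move=> /(congr1 (fun v => cst v)); rewrite rd_cst => /esym.
rewrite /cst map_mxB -![map_mx _ _]/(cst _) cstM embK => /eqP.
by rewrite subr_eq0 => /eqP.
Qed.

Lemma M1_surj (u : 'cV[k]_bG) : exists v, M1 *m v = u.
Proof.
have [v vE] := mu1_surj (emb n u : 'cV_bG); exists (cst (v : 'cV_bE)).
by rewrite -[RHS](embK n) -cstM vE (gmxE (lmap L 1)).
Qed.

Lemma M1_right_inverse : exists Q, M1 *m Q = 1%:M.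
Proof. by apply: col_factor => j; apply: M1_surj. Qed.

(** For any lift [v], [m0 *m v] is [g1 *m w]; surjectivity of [mu^1] gives [u] above [w], and
    [e1 *m u] corrects [v] without changing its class. *)
Lemma F_lift (y : F) : exists2 v : 'cV[R]_aE, m0 *m v = 0 & val y = raug resE v.
Proof.
have [v vE] := raug_surj resE (val y).
have /raug_ker[w wE] : raug resG (m0 *m v) = 0.
  by rewrite -mu_raug -vE; apply/eqP/(valP y).
have [u uE] := mu1_surj w; have {}uE := etrans uE (gmxE (lmap L 1) u).
exists (v - e1 *m u).
  by rewrite mulmxBr mulmxA -lift_comm -mulmxA -uE wE subrr.
rewrite linearB -vE (_ : raug resE (e1 *m u) = 0) ?subr0 //.
by apply/raug_ker; exists u.
Qed.

(** The generators are the columns of the constant projector [K] onto ker [m0]; a lift killed by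
    [m0] is fixed by [K]. *)
Lemma F_gens : exists g : 'I_aE -> F, (forall i, gpiece m (g i)) /\
  (forall y : F, exists c : 'I_aE -> R, y = \sum_i c i *: g i).
Proof.
have [Q M0Q] : exists Q, M0 *m Q = 1%:M by apply: col_factor => j; apply: M0_surj.
pose K := emb n (1%:M - Q *m M0).
have m0K : m0 *m K = 0.
  rewrite m0E -embM mulmxBr mulmxA M0Q mul1mx mulmx1 subrr.
  by apply/matrixP => i j; rewrite !mxE.
have gP i : raug resE (col i K) \in Defs.lker mu.
  by rewrite inE mu_raug -col_mul m0K colE mul0mx linear0.
exists (fun i => Sub (raug resE (col i K)) (gP i)); split=> [i|y].
  apply: (ghom_deg (raug resE) (d := m)) => j.
  by rewrite E_deg0 subrr mxE; apply: mhomog_emb.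
have [v m0v yE] := F_lift y; exists (fun i => v i 0); apply: val_inj.
have vE : v = K *m v.
  have -> : K = 1%:M - emb n Q *m m0.
    rewrite m0E -embM; apply/matrixP => i j; rewrite !mxE rmorphB /= rmorphMn /=.
    by rewrite mpolyC1.
  by rewrite mulmxBl mul1mx -mulmxA m0v mulmx0 subr0.
rewrite yE {1}vE mulmx_sum_col linear_sum.
transitivity (gker_inc mu (\sum_i v i 0 *: (Sub (raug resE (col i K)) (gP i) : F))); last first.
  by [].
by rewrite linear_sum; apply: eq_bigr => i _; rewrite !linearZ.
Qed.

Section Cover.
Variables (N : nat) (dg0 : 'I_N -> int) (c : grhom (gfree k n dg0) F).
Hypothesis c_surj : forall y, exists v, y = c v.
Hypothesis c_min : forall v, c v = 0 -> irrelevant_entries (v : 'cV_N).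

Hypothesis dg0E : forall i, dg0 i = m.

(** Generators of degree [m] lift to constant vectors, the columns of [T]. Injectivity of [T] is the
    minimality of [c], and exactness in the middle its surjectivity, since relations of [E] and [G]
    have no constant terms. *)
Lemma cover_split : exists (T : 'M[k]_(aE, N)) Q (S : 'M[k]_(N, aE)),
  [/\ forall v : 'cV[R]_N, val (c v) = raug resE (emb n T *m v),
      M0 *m T = 0, S *m T = 1%:M, T *m S = 1%:M - Q *m M0 & (N + aG = aE)%N].
Proof.
have /choice[w wP] : forall i, exists w : 'cV[k]_aE,
    val (c (delta_mx i 0 : 'cV_N)) = raug resE (emb n w).
  move=> i; have cd : gpiece m (val (c (delta_mx i 0 : 'cV_N))).
    apply: (ghom_deg (hcomp (gker_inc mu) c) (d := m)) => j.
    by rewrite dg0E subrr mxE; case: (_ && _); [apply: dhomog1 | apply: dhomog0].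
  have [v vm vE] := grhom_lift cd (raug_surj resE _).
  exists (cst (v : 'cV_aE)); rewrite vE; congr (raug resE _).
  by apply: mhomog0E => a b; rewrite ord1 -(subrr m) -{2}(E_deg0 a); apply: vm.
pose T : 'M[k]_(aE, N) := \matrix_(i, j) w j i 0.
have cT (v : 'cV[R]_N) : val (c v) = raug resE (emb n T *m v).
  have -> : val (c v) = \sum_j v j 0 *: val (c (delta_mx j 0 : 'cV_N)).
    exact: (linear_col_sum (hcomp (gker_inc mu) c) v).
  rewrite mulmx_sum_col linear_sum; apply: eq_bigr => j _; rewrite wP linearZ /=.
  by congr (_ *: raug resE _); apply/colP => i; rewrite !mxE.
have raug_cst0 (v : 'cV[R]_aE) : raug resE v = 0 -> cst v = 0.
  by move=> /raug_ker[u <-]; apply: rd_cst.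
have M0T : M0 *m T = 0.
  apply: mul_cV_eq => v; rewrite mul0mx -mulmxA.
  have /raug_ker[u uE] : raug resG (m0 *m (emb n T *m emb n v)) = 0.
    by rewrite -mu_raug -cT; apply/eqP/(valP (c (emb n v : 'cV_N))).
  by have := @rd_cst _ _ _ resG 0 u; rewrite uE !cstM !embK.
have [||||Q [S [_ ST TS dim]]] := @split_exact k aG aE N M0 T => //.
- exact: M0_surj.
- move=> v Tv; have : c (emb n v : 'cV_N) = 0.
    by apply: val_inj; rewrite cT -embM Tv /emb map_mx0 linear0.
  by move=> /c_min/cst_irrelevant; rewrite embK.
- move=> u M0u; have uF : raug resE (emb n u : 'cV_aE) \in Defs.lker mu.
    by rewrite inE mu_raug m0E -embM M0u /emb map_mx0 linear0.
  have [v vE] := c_surj (Sub (raug resE (emb n u : 'cV_aE)) uF : ker_mod mu); exists (cst (v : 'cV_N)).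
  have /raug_cst0 : raug resE (emb n u - emb n T *m v) = 0.
    by rewrite linearB -cT -vE /= subrr.
  rewrite /cst map_mxB -![map_mx _ _]/(cst _) cstM !embK => /eqP.
  by rewrite subr_eq0 => /eqP.
by exists T, Q, S.
Qed.

Variables (T : 'M[k]_(aE, N)) (Q : 'M[k]_(aE, aG)) (S : 'M[k]_(N, aE)).
Hypothesis cT : forall v : 'cV[R]_N, val (c v) = raug resE (emb n T *m v).
Hypothesis M0T : M0 *m T = 0.
Hypothesis ST : S *m T = 1%:M.
Hypothesis TS : T *m S = 1%:M - Q *m M0.

Lemma cover_ker (v : 'cV[R]_N) : c v = 0 <-> exists u, e1 *m u = emb n T *m v.
Proof.
split=> [cv|/raug_ker Tv]; last by apply: val_inj; rewrite cT Tv.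
by apply/raug_ker; rewrite -cT cv.
Qed.

Lemma emb_ST a (v : 'M[R]_(N, a)) : emb n S *m (emb n T *m v) = v.
Proof. by rewrite mulmxA -embM ST emb1 mul1mx. Qed.

Lemma emb_TS a (v : 'M[R]_(aE, a)) : m0 *m v = 0 -> emb n T *m (emb n S *m v) = v.
Proof.
move=> m0v; rewrite mulmxA -embM TS embB emb1 embM -m0E mulmxBl mul1mx.
by rewrite -mulmxA m0v mulmx0 subr0.
Qed.

(* T x = e1 u forces m1 u = g2 t, hence u = (1 - Q1 m1) u + Q1 g2 t: the columns of
   e1 (1 - Q1 m1) and of e1 Q1 g2 generate the syzygies, in degrees m+1 and m+2. *)
Lemma cover_ker_gens : exists K (g : 'I_K -> gker c) (dg : 'I_K -> int),
  [/\ forall l, gpiece (dg l) (g l),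
      forall y, exists a : 'I_K -> R, y = \sum_l a l *: g l
    & forall l, dg l = m + 1 \/ dg l = m + 2].
Proof.
have [Q1 M1Q] := M1_right_inverse.
pose X := row_mx (1%:M - emb n Q1 *m m1) (emb n Q1 *m g2).
have m1X : m1 *m X = row_mx 0 g2.
  have m1Q : m1 *m emb n Q1 = 1%:M by rewrite m1E -embM M1Q emb1.
  by rewrite mul_mx_row mulmxBr !mulmxA m1Q !mul1mx mulmx1 subrr.
have g12 : g1 *m g2 = 0.
  by apply: mul_cV_eq => v; rewrite mul0mx -mulmxA; apply/rd_ker; exists v.
have m0e1X : m0 *m (e1 *m X) = 0.
  by rewrite mulmxA -lift_comm -mulmxA m1X mul_mx_row mulmx0 g12 row_mx0.
pose Z := emb n S *m (e1 *m X).
have ZP l : (col l Z : 'cV_N) \in Defs.lker c.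
  rewrite inE; apply/eqP/cover_ker; exists (col l X).
  by rewrite -!col_mul emb_TS.
exists (bE + rrank resG 2)%N, (fun l => Sub (col l Z) (ZP l)).
exists (fun l => match split l with inl _ => m + 1 | inr _ => m + 2 end).
have He1 : mhomog 1 e1.
  by have := gmx_mhomog (rd resE 0) E_deg1 E_deg0; rewrite (_ : _ - _ = 1) //; lia.
have Hg2 : mhomog 1 g2.
  by have := gmx_mhomog (rd resG 1) G_deg2 G_deg1; rewrite (_ : _ - _ = 1) //; lia.
split=> [l|y|l]; last by case: (split l); [left|right].
- move=> i; rewrite dg0E /= /Z !mul_mx_row mxE; have := splitK l; case: (split l) => j <- /=.
  + rewrite row_mxEl (_ : m + 1 - m = 0 + (1 + 0)); last by lia.
    suff h : mhomog 0 (1%:M - emb n Q1 *m m1).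
      exact: (mhomogM (mhomog_emb n S) (mhomogM He1 h) i j).
    by rewrite m1E -embM -emb1 -embB; apply: mhomog_emb.
  rewrite row_mxEr (_ : m + 2 - m = 0 + (1 + (0 + 1))); last by lia.
  exact: (mhomogM (mhomog_emb n S) (mhomogM He1 (mhomogM (mhomog_emb n Q1) Hg2)) i j).
have /eqP/cover_ker[u uE] := valP y; set v := \val y in uE.
have /rd_ker[t tE] : g1 *m (m1 *m u) = 0.
  by rewrite mulmxA lift_comm -mulmxA uE m0E mulmxA -embM M0T /emb map_mx0 mul0mx.
have XE : X *m col_mx u t = u.
  by rewrite mul_row_col mulmxBl mul1mx -!mulmxA tE subrK.
exists (fun l => col_mx u t l 0); apply: val_inj.
transitivity (Z *m col_mx u t); first by rewrite -!mulmxA XE uE emb_ST.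
rewrite mulmx_sum_col.
transitivity (gker_inc c (\sum_l col_mx u t l 0 *: (Sub (col l Z) (ZP l) : gker c))).
  by rewrite linear_sum; apply: eq_bigr => l _; rewrite linearZ.
by [].
Qed.
Section Syzygies.
Variables (N1 : nat) (dg1 : 'I_N1 -> int) (p : grhom (gfree k n dg1) (gfree k n dg0)).
Hypothesis p_exact : forall v, c v = 0 <-> exists w, v = p w.
Hypothesis p_min : forall w, p w = 0 -> irrelevant_entries (w : 'cV_N1).
Hypothesis dg1E : forall j, dg1 j = m + 1 \/ dg1 j = m + 2.
Variables (N2 : nat) (f : 'I_N2 -> 'I_N1).
Hypothesis f_inj : injective f.
Hypothesis f_im : forall j, dg1 j = m + 1 <-> exists i, f i = j.
Local Notation B := (colsub f (gmx p)).

(** A linear syzygy, moved to [E^0] by [T], has degree [m + 1] and lies in the image of [e1], so it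
    lifts to a constant column of [U]. *)
Lemma linear_syzygies : exists U : 'M[k]_(bE, N2),
  [/\ e1 *m emb n U = emb n T *m B, M1 *m U = 0,
      forall u : 'cV_bE, M1 *m u = 0 -> exists a, U *m a = u & (N2 + bG = bE)%N].
Proof.
(* The inclusion of the syzygies of degree [m + 1] among all minimal ones. *)
pose I : 'M[R]_(N1, N2) := colsub f 1%:M.
have pI : gmx p *m I = B by rewrite mulmx_colsub mulmx1.
have cB (v : 'cV[R]_N2) : exists u, e1 *m u = emb n T *m (B *m v).
  apply/cover_ker/p_exact; exists (I *m v).
  by rewrite (gmxE p) mulmxA pI.
have dgf i : dg1 (f i) = m + 1 by apply/f_im; exists i.
have hB : mhomog 1 B.
  move=> i j; rewrite mxE (_ : 1 = dg1 (f j) - dg0 i); first exact: gmx_homog.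
  by rewrite dgf dg0E; lia.
have /choice[w wP] : forall j, exists w : 'cV[k]_bE,
    e1 *m emb n w = emb n T *m col j B.
  move=> j; have hTB : gpiece (g := gfree k n (@rdeg _ _ _ resE 0)) (m + 1)
      (emb n T *m col j B).
    move=> i; rewrite E_deg0 (_ : m + 1 - m = 0 + 1); last by lia.
    by rewrite -col_mul mxE; apply: mhomogM (mhomog_emb n T) hB i j.
  have [u uE] := cB (delta_mx j 0); rewrite -colE in uE.
  have ex : exists u, emb n T *m col j B = rd resE 0 u.
    by exists u; rewrite (gmxE (rd resE 0)) uE.
  have [v vm vE] := grhom_lift hTB ex.
  exists (cst (v : 'cV_bE)); rewrite vE (gmxE (rd resE 0)); congr (_ *m _).
  by apply/esym/mhomog0E => a b; rewrite ord1 -(subrr (m + 1)) -{2}(E_deg1 a); apply: vm.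
pose U : 'M[k]_(bE, N2) := \matrix_(i, j) w j i 0.
have eU : e1 *m emb n U = emb n T *m B.
  apply: col_eq => j; rewrite !col_mul -wP; congr (_ *m _).
  by apply/colP => i; rewrite !mxE.
(* [M1 *m U] is constant, yet its columns lie in ker [g1], that is in the image of [g2], which has
   no constant terms. *)
have M1U : M1 *m U = 0.
  apply: mul_cV_eq => v; rewrite mul0mx -mulmxA.
  have /rd_ker[u uE] : g1 *m (m1 *m (emb n U *m emb n v)) = 0.
    rewrite !mulmxA lift_comm -[m0 *m e1 *m _]mulmxA eU m0E mulmxA -embM M0T.
    by rewrite /emb map_mx0 !mul0mx.
  by have := @rd_cst _ _ _ resG 1 u; rewrite uE !cstM !embK.
have U_ex (u : 'cV_bE) : M1 *m u = 0 -> exists a, U *m a = u.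
  move=> M1u; have m0eu : m0 *m (e1 *m emb n u) = 0.
    by rewrite mulmxA -lift_comm -mulmxA m1E -embM M1u /emb map_mx0 mulmx0.
  pose v := emb n S *m (e1 *m emb n u); have Tv := emb_TS m0eu.
  have /p_exact pv : c v = 0 by apply/cover_ker; exists (emb n u).
  have vm : gpiece (g := gfree k n dg0) (m + 1) v.
    move=> i; rewrite dg0E (_ : m + 1 - m = 0 + (1 + 0)); last by lia.
    apply: (mhomogM (mhomog_emb n S) (mhomogM _ (mhomog_emb n u)) i 0).
    by have := gmx_mhomog (rd resE 0) E_deg1 E_deg0; rewrite (_ : _ - _ = 1) //; lia.
  have [z zm zE] := grhom_lift vm pv.
  (* In degree [m + 1], coordinates on linear syzygies are constants and those on syzygies of degree
     [m + 2] have degree -1, hence vanish. *)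
  have zI : z = I *m emb n (rowsub f (cst (z : 'cV_N1))).
    apply/colP => j; rewrite mxE.
    have [fj|/f_im ndj] := pselect (exists i, f i = j).
      have [i <-] := fj; rewrite (bigD1 i) //= !mxE eqxx mul1r big1 ?addr0 => [|i' ne].
        by apply: zhomog0E; have := zm (f i); rewrite dgf subrr.
      by rewrite !mxE (inj_eq f_inj) eq_sym (negbTE ne) mul0r.
    rewrite big1 => [|i _]; last first.
      rewrite !mxE; case: eqP => [jf|]; last by rewrite mul0r.
      by case: ndj; apply/f_im; exists i.
    have := zm j; have [//|->] := dg1E j.
    by rewrite (_ : _ - _ = Negz 0) //; lia.
  exists (rowsub f (cst (z : 'cV_N1))); set a := rowsub _ _ in zI *.
  (* The difference is constant and lies in the image of [e2], so it is zero. *)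
  have /rd_ker[t tE] : e1 *m (emb n U *m emb n a - emb n u) = 0.
    rewrite mulmxBr mulmxA eU -mulmxA -pI -mulmxA -zI -(gmxE p) -zE Tv subrr.
    by [].
  have := @rd_cst _ _ _ resE 1 t; rewrite tE /cst map_mxB -![map_mx _ _]/(cst _).
  by rewrite cstM !embK => /eqP; rewrite subr_eq0 => /eqP.
have [||||Q1 [S1 [_ _ _ dim]]] := @split_exact k bG bE N2 M1 U => //.
- exact: M1_surj.
(* Injectivity of [U]: a vector killed by [U] gives a constant relation among minimal syzygies,
   excluded by [p_min]. *)
- move=> v Uv.
  have TBv : emb n T *m (B *m emb n v) = 0.
    by rewrite mulmxA -eU -mulmxA -embM Uv /emb map_mx0 mulmx0.
  have /p_min/cst_irrelevant : p (I *m emb n v) = 0.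
    by rewrite (gmxE p) mulmxA pI -[LHS]emb_ST TBv mulmx0.
  rewrite cstM embK => Iv; apply/colP => i; have /colP/(_ (f i)) := Iv.
  rewrite !mxE (bigD1 i) //= !mxE eqxx mcoeff1 eqxx mul1r big1 ?addr0 // => i' ne.
  by rewrite !mxE (inj_eq f_inj) eq_sym (negbTE ne) mcoeff0 mul0r.
by exists U.
Qed.

Lemma linear_part_rank (x : 'I_n.+1 -> k) r s :
    (exists i, x i != 0) -> artinian (coker (nu2 L)) ->
    vector_bundle r (sheafify E) -> vector_bundle s (sheafify G) ->
  (\rank (evmx x B) + aG + r = aE + s)%N.
Proof.
move=> x0 art Eb Gb; have [U [eU M1U U_ex _]] := linear_syzygies.
have [rkE _] := frame_presentation E_deg0 Eb x0.
have [rkG exG] := frame_presentation G_deg0 Gb x0.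
suff : (\rank (evmx x g1) + \rank (evmx x B) = \rank (evmx x e1))%N by lia.
(* The two differ by the left-invertible factor [T]. *)
have -> : \rank (evmx x B) = \rank (evmx x e1 *m U).
  have := congr1 (fun A => evmx x A) eU; rewrite !evmxM !evmx_emb => ->.
  apply/eqP; rewrite eqn_leq mxrankM_maxr andbT.
  by rewrite -{1}[evmx x B]mul1mx -ST -mulmxA mxrankM_maxr.
apply: (@rank_snake _ _ _ _ _ _ _ _ M0 M1 U _ M1_right_inverse M1U U_ex).
  by rewrite -[M0](evmx_emb x) -[M1](evmx_emb x) -!evmxM -m0E -m1E lift_comm.
move=> v /exG vim; have [u] := ker_lift_at G_deg1 G_deg2 art x0 vim.
have -> : evmx x m1 = M1 by rewrite {1}m1E evmx_emb.
by exists u.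
Qed.
End Syzygies.
End Cover.
End KernelPresentation.

(** * Existence of minimal presentations and the theorem *)

Lemma mxrank_rowsub (k : fieldType) a b c (f : 'I_c -> 'I_a) (A : 'M[k]_(a, b)) :
  (forall i, exists j, f j = i) -> \rank (rowsub f A) = \rank A.
Proof.
move=> /choice[g fg]; apply/eqP; rewrite eqn_leq; apply/andP; split.
  exact/mxrankS/rowsub_sub.
have {1}-> : A = rowsub g (rowsub f A) by apply/matrixP => i j; rewrite !mxE fg.
exact/mxrankS/rowsub_sub.
Qed.

(** Two successive minimal covers, of [M] and of the kernel of the first cover. Finite generation of
    that kernel is assumed for every minimal cover, as the first one is produced inside the
    proof. *)
Lemma minpres_exists (k : fieldType) (n : nat) (M : grmod k n)
    K (g : 'I_K -> M) (dg : 'I_K -> int) :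
    (forall i, gpiece (dg i) (g i)) ->
    (forall y : M, exists c : 'I_K -> {mpoly k[n.+1]}, y = \sum_i c i *: g i) ->
    (forall N (dg0 : 'I_N -> int) (c : grhom (gfree k n dg0) M),
      (forall y, exists v, y = c v) ->
      (forall v, c v = 0 -> irrelevant_entries (v : 'cV_N)) ->
      exists K' (h : 'I_K' -> gker c) (dh : 'I_K' -> int),
        (forall l, gpiece (dh l) (h l)) /\
        (forall y, exists a : 'I_K' -> {mpoly k[n.+1]}, y = \sum_l a l *: h l)) ->
  inhabited (minpres M).
Proof.
move=> gd gen syz; have [N [dg0 [c [c_surj c_min]]]] := minimal_cover gd gen.
have [K' [h [dh [hd hgen]]]] := syz _ _ _ c_surj c_min.
have [N1 [dg1 [p [p_surj p_min]]]] := minimal_cover hd hgen.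
have p_exact v : c v = 0 <-> exists w, v = hcomp (gker_inc c) p w.
  split=> [cv|[w ->]]; last exact: (eqP (valP (p w))).
  have [w pw] := p_surj (Sub v (introT eqP cv) : ker_mod c).
  by exists w; rewrite /= -pw.
by split; apply: (MinPres c_surj p_exact c_min) => w pw; apply: p_min; apply: val_inj.
Qed.

Theorem theorem1p3 (k : closedFieldType) (k_char : 2%N \notin [pchar k]) (n : nat)
    (E G : grmod k n) (E_fg : finitely_generated E) (G_fg : finitely_generated G)
    (m : int) (resE : minres E) (resG : minres G)
    (E_lin : linearly_presented resE m 1) (G_lin : linearly_presented resG m 2)
    (mu : grhom E G) (mu_surj : forall y : G, exists x : E, y = mu x)
    (mu_ : reslift mu resE resG)
    (mu1_surj : forall w, exists v, w = lmap mu_ 1 v)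
    (r s : nat)
    (E_bundle : vector_bundle r (sheafify E))
    (G_bundle : vector_bundle s (sheafify G))
    (nu2_artinian : artinian (coker (nu2 mu_))) :
  let a : int := (betti resE 0 m)%:Z - (betti resG 0 m)%:Z in
  let b : int := (betti resE 1 (m + 1))%:Z - (betti resG 1 (m + 1))%:Z in
  let F := gker mu in
  [/\ inhabited (minpres F),
      forall P : minpres F,
        [/\ forall i, pdeg0 (m := P) i = m,
            forall j, pdeg1 (m := P) j = m + 1 \/ pdeg1 (m := P) j = m + 2,
            (#|[set i | pdeg0 (m := P) i == m]|)%:Z = a,
            (#|[set j | pdeg1 (m := P) j == m + 1]|)%:Z = b &
            constant_corank (linear_part P m) (r%:Z - s%:Z)] &
      isomorphic (sheafify F) (oker (sheafify_mor mu))].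
Proof.
have betti_all (M : grmod k n) (rs : minres M) i d :
    (forall l, rdeg (m := rs) (i := i) l = d) -> betti rs i d = rrank rs i.
  by move=> rsd; rewrite /betti -[RHS]card_ord -cardsT; apply: eq_card => l;
    rewrite !inE rsd eqxx.
rewrite (betti_all _ _ _ _ (E_deg0 E_lin)) (betti_all _ _ _ _ (G_deg0 G_lin)).
rewrite (betti_all _ _ _ _ (E_deg1 E_lin)) (betti_all _ _ _ _ (G_deg1 G_lin)).
move=> a b F; have [g [gm gen]] := F_gens E_lin G_lin mu_surj mu1_surj.
have deg0 N (dg0 : 'I_N -> int) (c : grhom (gfree k n dg0) F) :
    (forall y, exists v, y = c v) ->
    (forall v, c v = 0 -> irrelevant_entries (v : 'cV_N)) -> forall i, dg0 i = m.
  by move=> c_surj c_min i; have [l] := @minimal_cover_deg _ _ _ _ g (fun=> m) _ _ c gm gen c_surj c_min i.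
split; last exact: sheafify_gker.
  apply: (minpres_exists gm gen) => N dg0 c c_surj c_min.
  have c0 := deg0 _ _ _ c_surj c_min.
  have [T [Q [S [cT M0T ST TS _]]]] :=
    cover_split E_lin G_lin mu_surj mu_ c_surj c_min c0.
  have [K [h [dh [hd hgen _]]]] :=
    cover_ker_gens E_lin G_lin mu1_surj c0 cT M0T ST TS.
  by exists K, h, dh.
move=> P; have c0 := deg0 _ _ _ (@paug_surj _ _ _ P) (@paug_min _ _ _ P).
have [T [Q [S [cT M0T ST TS dim0]]]] :=
  cover_split E_lin G_lin mu_surj mu_ (@paug_surj _ _ _ P) (@paug_min _ _ _ P) c0.
have [K [h [dh [hd hgen dhE]]]] := cover_ker_gens E_lin G_lin mu1_surj c0 cT M0T ST TS.
(* [pd P], corestricted to the kernel of [paug P], is a minimal cover, so its degrees occur among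
   those of the known generators of the syzygies. *)
have d1 j : pdeg1 (m := P) j = m + 1 \/ pdeg1 (m := P) j = m + 2.
  have pp w : paug P (pd P w) = 0 by apply/paug_exact; exists w.
  have [||l ->] := @minimal_cover_deg _ _ _ _ h dh _ _ (gker_lift pp) hd hgen _ _ j.
  - move=> y; have /paug_exact[w wE] := eqP (valP y).
    by exists w; apply: val_inj.
  - by move=> w /(congr1 val); apply: pd_min.
  exact: dhE.
have card0 : #|[set i | pdeg0 (m := P) i == m]| = prank0 P.
  by rewrite -[RHS]card_ord -cardsT; apply: eq_card => i; rewrite !inE c0 eqxx.
have f_im j : pdeg1 (m := P) j = m + 1 <->
    exists i : 'I_#|[set j | pdeg1 (m := P) j == m + 1]|, enum_val i = j.
  split=> [dj|[i <-]]; last by have := enum_valP i; rewrite inE => /eqP.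
  have jP : j \in [set j | pdeg1 (m := P) j == m + 1] by rewrite inE dj.
  by exists (enum_rank_in jP j); rewrite enum_rankK_in.
have [U [_ _ _ dim1]] := linear_syzygies E_lin G_lin mu1_surj c0 cT M0T ST TS
  (@paug_exact _ _ _ P) (@pd_min _ _ _ P) d1 (@enum_val_inj _ _) f_im.
split=> //; first by rewrite card0 /a -dim0 PoszD addrK.
  by rewrite /b -dim1 PoszD addrK.
move=> x x0.
have := linear_part_rank E_lin G_lin mu1_surj c0 cT M0T ST TS
  (@paug_exact _ _ _ P) (@pd_min _ _ _ P) d1 (@enum_val_inj _ _) f_im
  x0 nu2_artinian E_bundle G_bundle.
(* All generators have degree [m], so the row selection in [linear_part] only reindexes the rows. *)
have -> : \rank (map_mx (meval x) (linear_part P m)) =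
    \rank (evmx x (colsub enum_val (gmx (pd P)))
      : 'M_(_, #|[set j | pdeg1 (m := P) j == m + 1]|)).
  rewrite -(@mxrank_rowsub _ _ _ _
    (enum_val : 'I_#|[set i | pdeg0 (m := P) i == m]| -> _)).
    by congr (\rank _); apply/matrixP => i j; rewrite !mxE.
  move=> i; have iP : i \in [set i | pdeg0 (m := P) i == m] by rewrite inE c0.
  by exists (enum_rank_in iP i); rewrite enum_rankK_in.
by rewrite card0; move: (mxrank _) dim0 => q; lia.
Qed.
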